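(* Let $G_N$ be distributed as $\mathrm{CM}_N(\mathbf 2)$, the 2-regular configuration model on $N$ vertices. Then, for any $\beta\ge0$ and $B\in\mathbb R$, $$\frac{S_N-P_N(S_N)}{\sqrt N}\ \longrightarrow\ \mathcal N(0,\chi)\qquad\text{in distribution with respect to } P_N,\ \text{as } N\to\infty,$$ where $\chi=\chi(\beta,B)$ is the thermodynamic limit $\lim_{N\to\infty}\chi_N(\beta,B)$ of the susceptibility of the Ising model on $\mathrm{CM}_N(\mathbf 2)$. Moreover, $\chi(\beta,B)$ is equal to the susceptibility $\chi^{d=1}(\beta,B)$ of the one-dimensional Ising model, i.e. $$\chi(\beta,B)=\chi^{d=1}(\beta,B)=\frac{\cosh(B)\,e^{-4\beta}}{\left(\sinh^2(B)+e^{-4\beta}\right)^{3/2}} .$$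
   Context: The configuration model with degree sequence $(d_i)_{i\in[N]}$ (with $\sum_i d_i$ even) is the random multigraph on $[N]=\{1,\dots,N\}$ obtained by attaching $d_i$ half-edges to vertex $i$ and pairing all half-edges uniformly at random, each pair forming an edge; self-loops and multiple edges are allowed. $\mathrm{CM}_N(\mathbf 2)$ is the case $d_i=2$ for all $i\in[N]$; $Q_N$ denotes its law. For a multigraph $G_N$ with edge multiset $E_N$, $\beta\ge0$, $B\in\mathbb R$ and $\sigma\in\{-1,1\}^N$, the random quenched measure is $$\mu_{G_N}(\sigma)=\frac{1}{Z_N(\beta,B)}\exp\Big[\beta\sum_{(i,j)\in E_N}\sigma_i\sigma_j+B\sum_{i\in[N]}\sigma_i\Big],$$ where each edge is counted once with multiplicity and $Z_N(\beta,B)$ is the normalizing partition function. The averaged quenched measure is $P_N(\sigma)=Q_N(\mu_{G_N}(\sigma))$, the expectation of $\mu_{G_N}(\sigma)$ over $G_N\sim Q_N$. The same symbols denote expectations. $S_N=\sum_{i\in[N]}\sigma_i$, and $\chi_N(\beta,B)=\operatorname{Var}_{\mu_{G_N}}(S_N/\sqrt N)$ is the random quenched susceptibility, whose limit $\chi(\beta,B)$ is non-random and is the second derivative in $B$ of the limiting pressure $\lim_{N\to\infty}\frac1N\log Z_N(\beta,B)$. The susceptibility of the one-dimensional Ising model is $\chi^{d=1}(\beta,B)=\frac{\partial^2}{\partial B^2}\log\lambda_+(\beta,B)$ with $\lambda_+(\beta,B)=e^{\beta}\left[\cosh(B)+\sqrt{\sinh^2(B)+e^{-4\beta}}\right]$.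 $\mathcal N(0,\chi)$ is the centered Gaussian with variance $\chi$. *)

(* Defs.v *)
From HB Require Import structures.
From mathcomp Require Export all_boot all_order all_algebra.
From mathcomp Require Export all_classical all_reals all_analysis.

Set Implicit Arguments.
Unset Strict Implicit.
Unset Printing Implicit Defensive.

Export Order.TTheory GRing.Theory Num.Theory numFieldNormedType.Exports.
Open Scope classical_set_scope.
Open Scope ring_scope.

Notation half_edge d := {i & 'I_(d i)}.

Definition is_pairing (N : nat) (d : 'I_N -> nat)
    (G : {set {set half_edge d}}) : bool :=
  finset.partition G [set: half_edge d]%SET && [forall e in G, #|e| == 2%N].

(* The multigraph is carried by the pairing itself: its edges are the blocks
   of G, and h \in e is attached to the vertex tag h.  Distinct blocks may
   join the same vertices, or have both ends at one vertex. *)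
Notation pairing d := {G : {set {set half_edge d}} | is_pairing G}.

Definition CM_law (R : realType) (N : nat) (d : 'I_N -> nat)
  (_ : pairing d) : R := #|{: pairing d}|%:R^-1.

Definition degree2 (N : nat) : 'I_N -> nat := fun=> 2%N.

Section FiniteProbability.
Variables (R : realType) (T : finType) (p : T -> R).

Definition mean (f : T -> R) : R := \sum_t p t * f t.

Definition variance (f : T -> R) : R := mean (fun t => (f t - mean f) ^+ 2).

Definition finite_cdf (f : T -> R) (x : R) : R := \sum_(t | f t <= x) p t.

End FiniteProbability.

Definition cvg_in_distribution (R : realType) (T : nat -> finType)
    (p f : forall n, T n -> R) (nu : set R -> \bar R) : Prop :=
  let F := fun y : R => fine (nu `]-oo, y]%classic) in
  forall x : R, {for x, continuous F} ->
    finite_cdf (p n) (f n) x @[n --> \oo] --> F x.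

(* normal_prob takes the standard deviation as second parameter. *)
Definition centered_gaussian (R : realType) (v : R) : set R -> \bar R :=
  normal_prob 0 (Num.sqrt v).

Section Ising.
Variables (R : realType) (N : nat).

Definition spin (s : {ffun 'I_N -> bool}) (i : 'I_N) : R := if s i then 1 else - 1.

Definition total_spin (s : {ffun 'I_N -> bool}) : R := \sum_i spin s i.

Variables (d : 'I_N -> nat) (beta B : R).

(* A block e = {h, h'} contributes the product of the spins at its two ends,
   so that a self-loop contributes 1. *)
Definition boltzmann_weight (G : pairing d) (s : {ffun 'I_N -> bool}) : R :=
  expR (beta * (\sum_(e in val G) \prod_(h in e) spin s (tag h))
        + B * total_spin s).

Definition partition_function (G : pairing d) : R :=
  \sum_s boltzmann_weight G s.

Definition quenched (G : pairing d) (s : {ffun 'I_N -> bool}) : R :=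
  boltzmann_weight G s / partition_function G.

Definition averaged_quenched (s : {ffun 'I_N -> bool}) : R :=
  mean (@CM_law R N d) (fun G => quenched G s).

Definition susceptibility (G : pairing d) : R :=
  variance (quenched G) (fun s => total_spin s / Num.sqrt N%:R).

End Ising.

(* Convergence to a non-random limit, almost surely under every coupling of
   the random graphs CM_N(2), N >= 0, on a common probability space. *)
Definition thermodynamic_limit (R : realType)
    (X : forall N, pairing (@degree2 N) -> R) (l : R) : Prop :=
  forall (disp : measure_display) (Omega : measurableType disp)
    (P : probability Omega R)
    (G : forall N, Omega -> pairing (@degree2 N)),
  (forall N g, measurable (G N @^-1` [set g]) /\
               P (G N @^-1` [set g]) = (CM_law R g)%:E) ->
  {ae P, forall w, X N (G N w) @[N --> \oo] --> l}.

Section OneDimensional.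
Variable R : realType.

Definition cosh (x : R) : R := (expR x + expR (- x)) / 2.
Definition sinh (x : R) : R := (expR x - expR (- x)) / 2.

Definition lambda_plus (beta B : R) : R :=
  expR beta * (cosh B + Num.sqrt (sinh B ^+ 2 + expR (- (4 * beta)))).

Definition susceptibility_1d (beta B : R) : R :=
  derive1n 2 (fun b => ln (lambda_plus beta b)) B.

End OneDimensional.

(* Main.v *)
From mathcomp Require Import zify ring lra.
From mathcomp Require Import measurable_realfun.
Require Import Defs.

(** The 2-regular multigraph is a disjoint union of cycles, and an Ising model
    on a cycle of length L has partition function
    tr(M^L) = lambda_plus^L + lambda_minus^L, where M is the 2x2 transfer
    matrix.  Hence, with r = lambda_minus / lambda_plus in [0, 1[ and N
    vertices,

      Z_G(b) = lambda_plus(b)^N * prod over the cycles of (1 + r(b)^L),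

    so that the graph only enters through one bounded factor per cycle
    ([cycle_structure], [trace_transfer], [partition_function_cycles]).

    The Laplace transform of the centered and rescaled total spin under the
    quenched measure is a ratio Z_G(B + t / sqrt N) / Z_G(B), up to a
    deterministic exponential.  Its first factor is deterministic and tends to
    exp(chi t^2 / 2) by Taylor's formula for the pressure log lambda_plus,
    whose second derivative is chi ([quenched_laplace], [cvg_bulk_factor]).
    Its second factor is between exp(- c K |t| / sqrt N) and
    exp(c K |t| / sqrt N), where K is the number of cycles, because r is locally
    Lipschitz and L rho^L is bounded in L for rho < 1
    ([prod_eigen_ratio_near]).

    The number of cycles is of logarithmic order.  When the half-edges are
    matched one after the other, the matched part of the graph consists of
    closed cycles and of paths; with 2 i half-edges left, the next match closes a
    cycle for exactly one of the 2 i - 1 possible partners.  Hence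
    E[3^K] = prod (2 i + 1) / (2 i - 1) = 2 N + 1 ([cycles_of_pairings]).
    Therefore the second factor tends to 1 in mean, and, by Borel-Cantelli, almost
    surely under every coupling of the graphs ([averaged_laplace_cvg],
    [cycle_count_ae]).

    So both the averaged measure and almost every sequence of quenched measures
    have Laplace transforms that converge, at every real t, to that of the
    centered Gaussian of variance chi.  This gives the convergence of the
    variances, hence the value of the limiting susceptibility, and that of the
    distribution functions ([clt_of_laplace]).  The passage from Laplace
    transforms to distribution functions is done by enlarging the class of
    functions whose means converge: from exponentials to polynomials by
    differentiating in t, from polynomials to cosines by power series, from
    cosines to trigonometric polynomials by the addition formulas, and
    finally to indicators of half-lines, which trigonometric polynomials
    approximate well enough ([steep_sandwich], [laplace_cvg_cdf]). *)

Set Implicit Arguments.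
Unset Strict Implicit.
Unset Printing Implicit Defensive.

(** * Pairings of a finite set *)

Section Pairings.
Local Close Scope classical_set_scope.
Local Open Scope set_scope.
Variable T : finType.

Definition pairings (X : {set T}) : {set {set {set T}}} :=
  [set G | finset.partition G X && [forall e in G, #|e| == 2%N]].

Lemma pairingsP (X : {set T}) (G : {set {set T}}) :
  reflect [/\ finset.cover G = X, finset.trivIset G & forall e, e \in G -> #|e| = 2%N]
          (G \in pairings X).
Proof.
rewrite inE; apply: (iffP andP) => [[/and3P[/eqP cG tG _] /forall_inP G2]|].
  by split=> // e /G2 /eqP.
case=> cG tG G2; split; last by apply/forall_inP => e /G2 ->.
apply/and3P; split=> //; first exact/eqP.
by apply/negP => /G2; rewrite cards0.
Qed.

Lemma pairing_block (X : {set T}) (G : {set {set T}}) x :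
  G \in pairings X -> x \in X -> exists2 y, y \in X :\ x & [set x; y] \in G.
Proof.
move=> /pairingsP[cG tG G2]; rewrite -cG => /bigcupP[e eG xe].
have /eqP/cards2P[a [b [ab eab]]] := G2 _ eG.
suff [y [yx exy]] : exists y, y != x /\ e = [set x; y].
  exists y; last by rewrite -exy.
  by rewrite !inE yx; apply/bigcupP; exists e => //; rewrite exy !inE eqxx orbT.
move: xe; rewrite eab !inE => /orP[/eqP->|/eqP->]; first by exists b; rewrite eq_sym.
by exists a; rewrite finset.setUC.
Qed.

Lemma pairing_block_uniq (X : {set T}) (G : {set {set T}}) x y z :
  G \in pairings X -> x != y -> [set x; y] \in G -> [set x; z] \in G -> z = y.
Proof.
move=> /pairingsP[_ tG _] xy yG zG.
have xyz : [set x; y] = [set x; z].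
  by rewrite -(@def_pblock _ _ _ x tG yG) ?finset.set21// (@def_pblock _ _ _ x tG zG) ?finset.set21.
have : y \in [set x; z] by rewrite -xyz finset.set22.
by rewrite !inE eq_sym (negbTE xy) => /eqP ->.
Qed.

Lemma pairing_notin (X : {set T}) (G : {set {set T}}) (e : {set T}) x :
  G \in pairings X -> x \in e -> x \notin X -> e \notin G.
Proof.
move=> /pairingsP[cG _ _] xe; apply: contra => eG.
by rewrite -cG; apply/bigcupP; exists e.
Qed.

Lemma pairing_extend (X : {set T}) (G : {set {set T}}) x y :
  x \in X -> y \in X :\ x -> G \in pairings (X :\ x :\ y) ->
  [set x; y] |: G \in pairings X.
Proof.
move=> xX yX GX; have /pairingsP[cG tG G2] := GX.
have /andP[yx yX'] : (y != x) && (y \in X) by move: yX; rewrite !inE.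
apply/pairingsP; split.
- rewrite /finset.cover finset.bigcup_setU finset.big_set1 -/(finset.cover G); apply/setP => z.
  rewrite cG !inE; case: eqP => [->|_]; first by rewrite xX.
  by case: eqP => [->|_].
- suff [] : finset.trivIset ([set x; y] |: G) /\ [set x; y] \notin G by [].
  apply/trivIsetU1 => // [e eG|]; last by apply/negP => /G2; rewrite cards0.
  rewrite -finset.setI_eq0; apply/eqP/setP => z; rewrite !inE; apply/negbTE/negP.
  move=> /andP[/orP[/eqP->|/eqP->]] ze.
    by have := pairing_notin GX ze; rewrite !inE eqxx andbF eG => /(_ isT).
  by have := pairing_notin GX ze; rewrite !inE eqxx eG => /(_ isT).
- by move=> e; rewrite !inE => /orP[/eqP->|/G2//]; rewrite cards2 eq_sym yx.
Qed.

Lemma pairing_remove (X : {set T}) (G : {set {set T}}) x y :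
  x != y -> G \in pairings X -> [set x; y] \in G ->
  G :\ [set x; y] \in pairings (X :\ x :\ y).
Proof.
move=> xy GX xyG; have /pairingsP[cG tG G2] := GX.
apply/pairingsP; split; last by move=> e; rewrite inE => /andP[_ /G2].
  apply/setP => z; apply/bigcupP/idP => [[e]|].
    rewrite !inE => /andP[exy eG] ze; rewrite -cG.
    have zc : z \in finset.cover G by apply/bigcupP; exists e.
    rewrite zc andbT; apply/andP; split; apply: contraNneq exy => zz; subst z.
      by rewrite -(def_pblock tG eG ze) (@def_pblock _ _ _ y tG xyG) ?finset.set22.
    by rewrite -(def_pblock tG eG ze) (@def_pblock _ _ _ x tG xyG) ?finset.set21.
  rewrite !inE -cG => /and3P[zy zx /bigcupP[e eG ze]]; exists e => //.
  rewrite !inE eG andbT; apply: contraTneq ze => ->.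
  by rewrite !inE negb_or zy zx.
by apply: trivIsetS tG; apply: finset.subD1set.
Qed.

(** A pairing is exposed one pair at a time: first the partner y of a chosen
    x, then a pairing of the remaining points. *)
Lemma sum_pairings (V : nmodType) (F : {set {set T}} -> V) (X : {set T}) x :
  x \in X ->
  \sum_(G in pairings X) F G =
  \sum_(y in X :\ x) \sum_(G in pairings (X :\ x :\ y)) F ([set x; y] |: G).
Proof.
move=> xX.
transitivity (\sum_(G in pairings X) \sum_(y in X :\ x | [set x; y] \in G) F G).
  apply: eq_bigr => G GX; have [y yX yG] := pairing_block GX xX.
  rewrite (big_pred1 y)// => z; apply/andP/eqP => [[_ zG]|->//].
  by apply: (pairing_block_uniq GX _ yG zG); move: yX; rewrite !inE eq_sym => /andP[].
rewrite (exchange_big_dep (mem (X :\ x)))/=; last by move=> ? ? _ /andP[].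
apply: eq_bigr => y yX; have yx : y != x by move: yX; rewrite !inE => /andP[].
rewrite (reindex_onto (fun G => [set x; y] |: G) (fun G => G :\ [set x; y])); last first.
  by move=> G /and3P[_ _ xyG]; rewrite finset.setD1K.
apply: eq_bigl => G; apply/idP/idP => [|GX].
  move=> /andP[/and3P[GX _ _] /eqP <-].
  by apply: pairing_remove => //; rewrite ?finset.setU11 1?eq_sym.
rewrite pairing_extend// yX finset.setU11/= finset.setU1K//.
by apply: (pairing_notin GX (finset.set21 x y)); rewrite !inE eqxx andbF.
Qed.

End Pairings.

(** * Cycles of a union of paths closed up by a pairing *)

Section Exploration.
Local Close Scope classical_set_scope.
Local Open Scope set_scope.
Variables (T : finType) (q : nat).

(** A state of the exploration is a list of disjoint paths: (x, y, k) is a path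
    whose two free half-edges are x and y and which contains k + 1 vertices.
    Counting vertices from k + 1 excludes paths without vertices, whose
    weight would be the inverse of the edge matrix. *)
Definition endseq (P : seq (T * T * nat)) : seq T :=
  flatten [seq [:: p.1.1; p.1.2] | p <- P].

Definition path_length (P : seq (T * T * nat)) : nat := \sum_(p <- P) p.2.+1.

Section Weights.
Variable R : comPzRingType.
Variables (D W : 'M[R]_q) (phi : {set T} -> {ffun T -> 'I_q} -> R).

(** D is the diagonal matrix of vertex weights and W the matrix of edge
    weights: the sum over the inner spins of a path with k + 1 vertices is
    D W D ... W D. *)
Definition path_mx (k : nat) : 'M[R]_q := (D *m W) ^+ k *m D.

Definition path_weight (P : seq (T * T * nat)) (s : {ffun T -> 'I_q}) : R :=
  \prod_(p <- P) path_mx p.2 (s p.1.1) (s p.1.2).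

(** The sum ranges over the spins of all points of T, also those that are no
    end of a path; each of these only contributes a factor q.  This keeps the
    index type fixed when ends are removed. *)
Definition path_partition P (G : {set {set T}}) : R :=
  \sum_s path_weight P s * \prod_(e in G) phi e s.

Definition upd (s : {ffun T -> 'I_q}) x a : {ffun T -> 'I_q} :=
  [ffun z => if z == x then a else s z].

Lemma updx s x a : upd s x a x = a. Proof. by rewrite ffunE eqxx. Qed.

Lemma upd_neq s x a z : z != x -> upd s x a z = s z.
Proof. by rewrite ffunE => /negbTE ->. Qed.

(** Summing out the spin at x without removing x from T: the sum is counted
    once for each of the q values that the forgotten spin had. *)
Lemma sum_upd (F : {ffun T -> 'I_q} -> R) x :
  \sum_s \sum_a F (upd s x a) = q%:R * \sum_s F s.
Proof.
rewrite pair_big/= (reindex (fun sa => (upd sa.1 x sa.2, sa.1 x)))/=; last first.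
  exists (fun sa => (upd sa.1 x sa.2, sa.1 x)) => -[s a] _ /=;
    by rewrite updx; congr pair; apply/ffunP => z; rewrite !ffunE; case: eqP => [->|].
transitivity (\sum_(sa : {ffun T -> 'I_q} * 'I_q) F sa.1).
  apply: eq_bigr => -[s a] _ /=; congr F; apply/ffunP => z; rewrite !ffunE.
  by case: eqP => [->|].
rewrite -(pair_big predT predT (fun s _ => F s))/= mulr_sumr.
by apply: eq_bigr => s _; rewrite sumr_const card_ord mulr_natl.
Qed.

Lemma sum_upd2 (F : {ffun T -> 'I_q} -> R) x y :
  \sum_s \sum_a \sum_b F (upd (upd s x a) y b) = q%:R ^+ 2 * \sum_s F s.
Proof. by rewrite expr2 -mulrA -(sum_upd F y) -(sum_upd _ x). Qed.

Hypotheses (DT : D^T = D) (WT : W^T = W).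
Hypothesis phiE : forall x y s, x != y -> phi [set x; y] s = W (s x) (s y).

Lemma path_mx_join k m : path_mx k *m W *m path_mx m = path_mx (k + m).+1.
Proof.
rewrite /path_mx -addnS exprD [(D *m W) ^+ m.+1]exprS.
rewrite -[in RHS]mulmxE !mulmxA.
by [].
Qed.

Lemma path_mx0 : path_mx 0 = D.
Proof. by rewrite /path_mx expr0 mul1mx. Qed.

Lemma path_mx_sym k : (path_mx k)^T = path_mx k.
Proof.
elim: k => [|k IH]; first by rewrite path_mx0.
have E : path_mx k.+1 = path_mx k *m W *m path_mx 0 by rewrite path_mx_join addn0.
rewrite [in LHS]E (trmx_mul (path_mx k *m W)) (trmx_mul (path_mx k)) IH path_mx0 DT WT.
by rewrite mulmxA -{1}path_mx0 path_mx_join.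
Qed.

Lemma path_mxC k a b : path_mx k a b = path_mx k b a.
Proof. by have /matrixP/(_ b a) := path_mx_sym k; rewrite mxE. Qed.

Lemma path_mx_tr k : \sum_a \sum_b path_mx k a b * W a b = \tr ((D *m W) ^+ k.+1).
Proof.
rewrite exprSr -mulmxE mulmxA -/(path_mx k) /mxtrace; apply: eq_bigr => a _.
rewrite [RHS]mxE; apply: eq_bigr => b _; congr (_ * _).
by have /matrixP/(_ b a) := WT; rewrite mxE.
Qed.

Lemma path_weight_upd P s x a : x \notin endseq P ->
  path_weight P (upd s x a) = path_weight P s.
Proof.
rewrite /path_weight; elim: P => [|p P IH]; first by rewrite !big_nil.
rewrite /= !inE !negb_or => /and3P[xp1 xp2 xP].
by rewrite !big_cons IH// !upd_neq 1?eq_sym.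
Qed.

Lemma pairing_weight_upd (X : {set T}) G s x a : G \in pairings X -> x \notin X ->
  \prod_(e in G) phi e (upd s x a) = \prod_(e in G) phi e s.
Proof.
move=> GX xX; apply: eq_bigr => e eG.
have xe : x \notin e by apply: contraL eG => xe; exact: pairing_notin GX xe xX.
have /pairingsP[_ _ /(_ _ eG) /eqP/cards2P[y [z [yz ee]]]] := GX.
move: xe; rewrite ee !inE negb_or => /andP[xy xz].
by rewrite !phiE// !upd_neq 1?eq_sym.
Qed.

(** The sum over the two matched spins contracts the path matrix with W, which
    gives the trace of (D W)^(k + 1). *)
Lemma close_partition P (X : {set T}) G x y k : x != y ->
  x \notin endseq P -> y \notin endseq P -> x \notin X -> y \notin X ->
  G \in pairings X ->
  path_partition ((x, y, k) :: P) ([set x; y] |: G) * q%:R ^+ 2 =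
  \tr ((D *m W) ^+ k.+1) * path_partition P G.
Proof.
move=> xy xP yP xX yX GX.
have eG : [set x; y] \notin G by apply: pairing_notin GX (finset.set21 _ _) xX.
rewrite mulrC -(sum_upd2 _ x y) mulr_sumr; apply: eq_bigr => s _.
rewrite -path_mx_tr mulr_suml; apply: eq_bigr => a _.
rewrite mulr_suml; apply: eq_bigr => b _.
rewrite /path_weight big_cons -/(path_weight P _) big_setU1//= phiE//.
rewrite !(pairing_weight_upd _ _ GX)// !path_weight_upd//.
rewrite !updx upd_neq// updx.
by rewrite mulrACA.
Qed.

(** The sum over the two matched spins is a product of matrices, the matrix of
    a path with k + m + 2 vertices. *)
Lemma join_partition P (X : {set T}) G x x' y y' k m :
  uniq [:: x, x', y, y' & endseq P] ->
  x \notin X -> y \notin X -> G \in pairings X ->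
  path_partition [:: (x, x', k), (y, y', m) & P] ([set x; y] |: G) * q%:R ^+ 2 =
  path_partition ((x', y', (k + m).+1) :: P) G.
Proof.
move=> U xX yX GX; move: U; rewrite /= !inE !negb_or.
move=> /and5P[/and4P[xx' xy xy' xP] /and3P[x'y x'y' x'P] /andP[yy' yP] y'P _].
have eG : [set x; y] \notin G by apply: pairing_notin GX (finset.set21 _ _) xX.
rewrite mulrC -(sum_upd2 _ x y); apply: eq_bigr => s _.
rewrite /path_weight big_cons -/(path_weight P _) /=.
rewrite -path_mx_join mxE !mulr_suml exchange_big/=; apply: eq_bigr => b _.
rewrite mxE !mulr_suml; apply: eq_bigr => a _.
rewrite !big_cons/= -/(path_weight P _) big_setU1//= phiE//.
rewrite !(pairing_weight_upd _ _ GX)// !path_weight_upd//.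
rewrite !updx ![upd (upd _ _ _) _ _ _]upd_neq// 1?eq_sym// updx.
rewrite !upd_neq// 1?eq_sym//.
rewrite [path_mx k a _]path_mxC; ring.
Qed.

End Weights.

Lemma size_endseq P : size (endseq P) = (2 * size P)%N.
Proof. by elim: P => //= p P; rewrite /endseq /= => ->; rewrite mulnS. Qed.

(** Since path weights are symmetric, the path ending at a given y can be
    moved to the front of the list and oriented so that it starts at y. *)
Lemma pick_path P y : y \in endseq P -> exists y' m P1,
  [/\ perm_eq (endseq P) [:: y, y' & endseq P1], size P = (size P1).+1,
      path_length P = (m.+1 + path_length P1)%N &
      forall (R : comPzRingType) (D W : 'M[R]_q), D^T = D -> W^T = W ->
      forall s, path_weight D W P s = path_weight D W ((y, y', m) :: P1) s].
Proof.
elim: P => //= -[[a b] k] P IH; rewrite !inE => /or3P[/eqP->|/eqP->|/IH].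
- exists b, k, P; split=> //; by rewrite /path_length big_cons.
- exists a, k, P; split=> //.
  + exact: permEl (perm_catCA [:: a] [:: b] (endseq P)).
  + by rewrite /path_length big_cons.
  + move=> R D W DT WT s; rewrite /path_weight !big_cons/=.
    by rewrite (path_mxC DT WT).
move=> [y' [m [P1 [pP sP lP wP]]]]; exists y', m, ((a, b, k) :: P1); split.
- rewrite -[endseq _]/([:: a; b] ++ endseq P) -[endseq (_ :: P1)]/([:: a; b] ++ endseq P1).
  rewrite -[X in perm_eq _ X]/([:: y; y'] ++ [:: a; b] ++ endseq P1).
  by rewrite perm_sym perm_catCA perm_cat2l perm_sym.
- by rewrite /= sP.
- by move: lP; rewrite /path_length !big_cons/= => ->; lia.
- move=> R D W DT WT s; have := wP R D W DT WT s; rewrite /path_weight !big_cons/= => ->.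
  by rewrite mulrCA.
Qed.

(** ls lists the cycle lengths of the graph made of the paths P and the edges
    G.  The weights are quantified here because the same lengths have to serve
    for two values of the field. *)
Definition cycle_data P (G : {set {set T}}) (ls : seq nat) : Prop :=
  sumn ls = path_length P /\
  forall (R : comPzRingType) (D W : 'M[R]_q) (phi : {set T} -> {ffun T -> 'I_q} -> R), D^T = D -> W^T = W ->
    (forall x y s, x != y -> phi [set x; y] s = W (s x) (s y)) ->
    path_partition D W phi P G * q%:R ^+ size (endseq P) =
    q%:R ^+ #|T| * \prod_(L <- ls) \tr ((D *m W) ^+ L).

Definition endset P : {set T} := [set x in endseq P].

Lemma pairings0 : pairings (finset.set0 : {set T}) = [set finset.set0].
Proof.
apply/setP => G; apply/idP/idP => [/pairingsP[cG _ G2]|]; rewrite inE.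
  apply/eqP/setP => e; rewrite inE; apply/negP => eG; have := G2 _ eG.
  suff -> : e = finset.set0 by rewrite cards0.
  by apply/eqP; rewrite -finset.subset0 -cG; apply: finset.bigcup_sup.
move=> /eqP->; apply/pairingsP; split=> [||e]; last by rewrite inE.
  by rewrite /finset.cover big_set0.
by apply/finset.trivIsetP => ? ?; rewrite inE.
Qed.

Lemma card_pairings n (X : {set T}) : #|X| = (2 * n)%N ->
  #|pairings X| = (\prod_(i < n) (2 * i).+1)%N.
Proof.
elim: n X => [|n IH] X cX.
  by rewrite (cards0_eq cX) pairings0 cards1 big_ord0.
have [x xX] : exists x, x \in X by apply/card_gt0P; rewrite cX.
rewrite -sum1_card (sum_pairings _ xX) big_ord_recr/= mulnC.
have cx : #|X :\ x| = (2 * n).+1 by have := cardsD1 x X; rewrite xX cX; lia.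
under eq_bigr => y yX.
  rewrite sum1_card IH; last by have := cardsD1 y (X :\ x); rewrite yX cx; lia.
  over.
by rewrite -[LHS]/(\sum_(y in X :\ x) _)%N sum_nat_const cx.
Qed.

(** The end x of the first path is matched first.  Its partner closes a cycle
    if it is x', the other end of the same path, and merges two paths for the
    2 n other choices of it.  Hence 3^(number of cycles) gets the factor
    3 + 2 n, against 1 + 2 n for the number of pairings. *)
Lemma cycles_of_pairings n P : size P = n -> uniq (endseq P) ->
  exists2 C : {set {set T}} -> seq nat,
    forall G, G \in pairings (endset P) -> cycle_data P G (C G) &
    (\sum_(G in pairings (endset P)) 3 ^ size (C G) = \prod_(i < n) (2 * i + 3))%N.
Proof.
elim: n P => [|n IH] [|[[x x'] k] P] //=.
  move=> _ _; exists (fun=> [::]) => [G|].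
    rewrite (_ : endset _ = finset.set0); last by apply/setP => z; rewrite !inE.
    rewrite pairings0 inE => /eqP ->; split=> [|R D W phi _ _ _].
      by rewrite /path_length big_nil.
    rewrite big_nil mulr1 expr0 mulr1 /path_partition.
    under eq_bigr do rewrite /path_weight big_nil big_set0 mulr1.
    by rewrite sumr_const card_ffun card_ord natrX.
  rewrite (_ : endset _ = finset.set0); last by apply/setP => z; rewrite !inE.
  by rewrite pairings0 sum_nat_const cards1 big_ord0.
move=> [sP]; rewrite inE negb_or => /and3P[/andP[xx' xP] x'P uP].
set P0 := _ :: P; have xE : x \in endset P0 by rewrite inE mem_head.
(* The claim restricted to the pairings that match x with y. *)
pose step y (C : {set {set T}} -> seq nat) :=
  (forall G, G \in pairings (endset P0 :\ x :\ y) -> cycle_data P0 ([set x; y] |: G) (C G)) /\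
  (\sum_(G in pairings (endset P0 :\ x :\ y)) 3 ^ size (C G) =
   (if y == x' then 3 else 1) * \prod_(i < n) (2 * i + 3))%N.
have step_ex y : y \in endset P0 :\ x -> exists C, step y C.
  have [->|yx'] := eqVneq y x'.
    have EX : endset P0 :\ x :\ x' = endset P.
      apply/setP => z; rewrite !inE; case: (eqVneq z x') => [->|_]/=; first by rewrite (negbTE x'P).
      by case: (eqVneq z x) => [->|_]//=; rewrite (negbTE xP).
    have [C CP sC] := IH P sP uP.
    move=> _; exists (fun G => k.+1 :: C G); rewrite /step EX eqxx; split.
      move=> G GX; have [sumC CZ] := CP G GX; split=> [|R D W phi DT WT phiE].
        by rewrite /= sumC /path_length big_cons.
      rewrite big_cons [RHS]mulrCA -(CZ R D W phi)// [size _]/= -addn2 exprD [RHS]mulrA.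
      rewrite -(@close_partition _ _ _ phi WT phiE P _ G x x' k xx' xP x'P _ _ GX); last 2 first.
      - by rewrite inE.
      - by rewrite inE.
      by rewrite mulrAC mulrA.
    by rewrite -sC big_distrr; apply: eq_bigr => G _; rewrite /= expnS.
  rewrite !inE (negbTE yx')/= => /andP[yx]; rewrite (negbTE yx)/= => yP.
  have [y' [m [P1 [pP sP1 lP wP]]]] := pick_path yP.
  have uP1 : uniq [:: y, y' & endseq P1] by rewrite -(perm_uniq pP).
  have mP1 z : (z \in endseq P) = [|| z == y, z == y' | z \in endseq P1].
    by rewrite (perm_mem pP) !inE.
  set P2 := (x', y', (k + m).+1) :: P1.
  have EX : endset P0 :\ x :\ y = endset P2.
    apply/setP => z; rewrite !inE mP1.
    case: (eqVneq z y) => [->|_]/=.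
      rewrite (negbTE yx')/=; move: uP1; rewrite /= !inE negb_or.
      by move=> /andP[/andP[/negbTE -> /negbTE ->]].
    case: (eqVneq z x) => [->|_]//=.
    rewrite (negbTE xx'); move: xP; rewrite mP1 !negb_or.
    by move=> /and3P[_ /negbTE -> /negbTE ->].
  have uP2 : uniq (endseq P2).
    move: uP1 x'P; rewrite /= !inE mP1 !negb_or => /and3P[/andP[yy' yP1] -> ->].
    by move=> /and3P[_ -> ->].
  have [||C CP sC] := IH P2; [by rewrite /= -sP1 | by [] |].
  exists C; rewrite /step EX (negbTE yx') mul1n; split=> // G GX.
  have [sumC CZ] := CP G GX; split=> [|R D W phi DT WT phiE].
    rewrite sumC /path_length !big_cons/=; move: lP; rewrite /path_length => ->.
    by rewrite !addnA !addSn addnS.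
  rewrite -(CZ R D W phi)// !size_endseq [size P0]/= [size P2]/= sP1 mulnS addnC exprD mulrA mulrAC.
  rewrite -[X in _ = X * _](@join_partition _ _ _ phi DT WT phiE P1 _ G x x' y y' k m _ _ _ GX).
  - congr (_ * _ * _); apply: eq_bigr => s _; congr (_ * _).
    transitivity (path_mx D W k (s x) (s x') * path_weight D W P s).
      by rewrite /path_weight big_cons.
    by rewrite wP// /path_weight [RHS]big_cons.
  - have U : uniq ([:: x; x'] ++ endseq P) by rewrite /= !inE negb_or xx' xP x'P uP.
    have pP' : perm_eq ([:: x; x'] ++ endseq P) ([:: x; x'] ++ [:: y, y' & endseq P1]).
      by rewrite perm_cat2l.
    by rewrite (perm_uniq pP') in U.
  - by rewrite -EX !inE eqxx andbF.
  - by rewrite -EX !inE eqxx.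
have /choice[C HC] : forall y, exists C, y \in endset P0 :\ x -> step y C.
  move=> y; case: (boolP (y \in endset P0 :\ x)) => [/step_ex[C HC]|_]; first by exists C.
  by exists (fun=> [::]).
(* The default x is never used, as each pairing matches x. *)
pose mate (G : {set {set T}}) := odflt x [pick y in endset P0 :\ x | [set x; y] \in G].
have pickE y G : y \in endset P0 :\ x -> G \in pairings (endset P0) -> [set x; y] \in G ->
    mate G = y.
  rewrite /mate; move=> yE GX yG; case: pickP => [z /andP[zE zG]|/(_ y)]/=; last by rewrite yE yG.
  apply: pairing_block_uniq GX _ yG zG.
  by move: yE; rewrite !inE eq_sym => /andP[].
exists (fun G : {set {set T}} => C (mate G) (G :\ [set x; mate G])) => [G GX|].
  have [y yE yG] := pairing_block GX xE; rewrite (pickE y)//.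
  have [Cy _] := HC y yE; have := Cy (G :\ [set x; y]); rewrite finset.setD1K//; apply.
  by apply: pairing_remove => //; move: yE; rewrite !inE eq_sym => /andP[].
rewrite (sum_pairings _ xE) big_ord_recr/= mulnC.
have E1 : forall y, y \in endset P0 :\ x -> forall G, G \in pairings (endset P0 :\ x :\ y) ->
   [set x; y] \notin G.
  move=> y _ G GX; apply: (pairing_notin GX (finset.set21 x y)).
  by rewrite !inE eqxx andbF.
under eq_bigr => y yE.
  under eq_bigr => G GX do
    rewrite (pickE y)// ?finset.setU11// ?(pairing_extend xE yE GX)// finset.setU1K ?(E1 y yE)//.
  have [_ ->] := HC y yE; over.
rewrite -big_distrl/=; congr muln.
have x'A : x' \in endset P0 :\ x by rewrite !inE eq_sym xx' eqxx orbT.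
have : #|endset P0 :\ x| = (2 * n).+1.
  have := cardsD1 x (endset P0); rewrite xE.
  have -> : #|endset P0| = (2 * n.+1)%N.
    rewrite cardsE; have /card_uniqP -> : uniq (endseq P0).
      by rewrite /= !inE negb_or xx' xP x'P uP.
    by rewrite size_endseq /= sP.
  by lia.
move=> cA; rewrite (bigD1 x' x'A)/= eqxx (eq_bigr (fun=> 1%N)); last first.
  by move=> y /andP[_ /negbTE ->].
move: cA; rewrite -sum1_card (bigD1 x' x'A)/= => E2.
by rewrite addnC; congr addn; exact: succn_inj E2.
Qed.
End Exploration.

(** * The Ising model on a 2-regular multigraph *)

Section CycleStructure.
Local Close Scope classical_set_scope.

Definition vertex_mx (R : realType) (B : R) : 'M[R]_2 :=
  \matrix_(a, b) if a == b then expR (B * (-1) ^+ a) else 0.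

Definition edge_mx (R : realType) (beta : R) : 'M[R]_2 :=
  \matrix_(a, b) expR (beta * ((-1) ^+ a * (-1) ^+ b)).

Definition transfer_mx (R : realType) (beta B : R) : 'M[R]_2 :=
  vertex_mx B *m edge_mx beta.

Variable N : nat.
Local Notation T := (half_edge (@degree2 N)).

Definition half_at (b : 'I_2) (i : 'I_N) : T := existT (fun i => 'I_(@degree2 N i)) i b.

(** Before the exploration starts, each vertex is a path joining its own two
    half-edges. *)
Definition vertex_paths : seq (T * T * nat) :=
  [seq (half_at ord0 i, half_at ord_max i, 0%N) | i <- enum 'I_N].

Lemma half_eq b b' i i' : (half_at b i == half_at b' i') = (b == b') && (i == i').
Proof.
apply/eqP/andP => [h|[/eqP-> /eqP->]//]; split; last by rewrite (congr1 tag h : i = i').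
by have := congr1 (fun h : T => nat_of_ord (tagged h)) h => /= /val_inj ->.
Qed.

Lemma halfP (h : T) : h = half_at ord0 (tag h) \/ h = half_at ord_max (tag h).
Proof.
case: h => i; rewrite /degree2 => b /=; rewrite /half_at.
case: b => -[|[|//]] p; [left|right];
  by congr existT; exact: val_inj.
Qed.

Lemma mem_endseq_paths (r : seq 'I_N) b i :
  (half_at b i \in endseq [seq (half_at ord0 i, half_at ord_max i, 0%N) | i <- r]) = (i \in r).
Proof.
elim: r => [//|j r IH].
rewrite /endseq /= -/(endseq _) !inE IH !half_eq orbA -andb_orl; congr orb.
by case: b {IH} => -[|[|//]].
Qed.

Lemma uniq_endseq_paths : uniq (endseq vertex_paths).
Proof.
rewrite /vertex_paths; have := enum_uniq 'I_N; elim: (enum 'I_N) => //= i r IH /andP[ir ur].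
by rewrite !inE !mem_endseq_paths negb_or half_eq ir IH.
Qed.

Lemma endset_paths : endset vertex_paths = [set: T]%SET.
Proof.
apply/setP => h; rewrite !inE; have [->|->] := halfP h;
  by rewrite mem_endseq_paths mem_enum.
Qed.

Lemma size_paths : size vertex_paths = N.
Proof. by rewrite size_map size_enum_ord. Qed.

Lemma card_half_edge : #|{: T}| = (2 * N)%N.
Proof.
by rewrite -cardsT -endset_paths cardsE (card_uniqP _) ?uniq_endseq_paths ?size_endseq ?size_paths.
Qed.

Lemma path_length_paths : path_length vertex_paths = N.
Proof. by rewrite /path_length big_map big_enum sum1_card card_ord. Qed.

Lemma pairing_sum (V : nmodType) (F : {set {set T}} -> V) :
  \sum_(G : pairing (@degree2 N)) F (val G) = \sum_(G in pairings [set: T]%SET) F G.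
Proof.
rewrite (reindex_omap (val : pairing (@degree2 N) -> _) insub)/=; last first.
  by move=> G; rewrite inE => GP; rewrite insubT.
apply: eq_bigl => G; rewrite inE; apply/esym.
by rewrite valK eqxx andbT; exact: (valP G).
Qed.

Section Partition.
Variables (R : realType) (beta B : R).

Definition edge_weight (e : {set T}) (s : {ffun T -> 'I_2}) : R :=
  expR (beta * \prod_(h in e) (-1) ^+ s h).

Lemma edge_weightE x y s : x != y ->
  edge_weight [set x; y]%SET s = edge_mx beta (s x) (s y).
Proof.
move=> xy; rewrite mxE /edge_weight big_setU1 ?inE//= big_set1.
by [].
Qed.

(** Spins are moved from vertices to half-edges.  The vertex matrix is
    diagonal, so it kills the assignments that give different spins to the two
    half-edges of a vertex. *)
Lemma partition_function_paths (G : pairing (@degree2 N)) :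
  partition_function beta B G =
  path_partition (vertex_mx B) (edge_mx beta) edge_weight vertex_paths (val G).
Proof.
pose sq (s : {ffun 'I_N -> bool}) : {ffun T -> 'I_2} :=
  [ffun h => if s (tag h) then ord0 else ord_max].
pose qs (s : {ffun T -> 'I_2}) : {ffun 'I_N -> bool} := [ffun i => s (half_at ord0 i) == ord0].
have wE s : path_weight (vertex_mx B) (edge_mx beta) vertex_paths s =
    \prod_i vertex_mx B (s (half_at ord0 i)) (s (half_at ord_max i)).
  rewrite /path_weight big_map big_enum/=; apply: eq_bigr => i _.
  by rewrite path_mx0.
rewrite /path_partition (bigID (fun s => sq (qs s) == s))/= [X in _ + X]big1 ?addr0; last first.
  move=> s sN; rewrite wE.
  suff [i Hi] : exists i, s (half_at ord0 i) != s (half_at ord_max i).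
    by rewrite (bigD1 i)//= mxE (negbTE Hi) !mul0r.
  apply/existsP; apply: contraNT sN; rewrite negb_exists => /forallP H.
  apply/eqP/ffunP => h; rewrite !ffunE.
  have := H (tag h); rewrite negbK => /eqP E.
  have F : s h = s (half_at ord0 (tag h)) by have [{1}->|{1}->] := halfP h.
  rewrite F; case: (s _) => -[|[|//]] p; exact: val_inj.
(* Only the spins that come from an assignment on the vertices remain. *)
rewrite (reindex_onto sq qs)/=; last by move=> s /eqP.
have sqK : cancel sq qs.
  by move=> s; apply/ffunP => i; rewrite !ffunE /=; case: (s i).
under [RHS]eq_bigl => s do rewrite sqK !eqxx.
apply: eq_bigr => s _; rewrite wE /boltzmann_weight addrC expRD; congr (_ * _).
  rewrite /total_spin mulr_sumr expR_sum; apply: eq_bigr => i _.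
  by rewrite mxE !ffunE eqxx /spin/=; case: (s i).
rewrite mulr_sumr expR_sum; apply: eq_bigr => e _; congr (expR (_ * _)).
by apply: eq_bigr => h _; rewrite ffunE /spin; case: (s _).
Qed.

End Partition.

Lemma vertex_mx_sym (R : realType) (B : R) : (vertex_mx B)^T = vertex_mx B.
Proof. by apply/matrixP => a b; rewrite !mxE eq_sym; case: eqP => // ->. Qed.

Lemma edge_mx_sym (R : realType) (beta : R) : (edge_mx beta)^T = edge_mx beta.
Proof. by apply/matrixP => a b; rewrite !mxE [_ * (-1) ^+ a]mulrC. Qed.

(** All that the limit theorems use about the graph: cycle lengths that add
    up to N, the product formula that they satisfy at every temperature and
    field, and E[3^K] = 2 N + 1 for the number K of cycles. *)
Theorem cycle_structure : exists C : pairing (@degree2 N) -> seq nat,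
  [/\ forall G, sumn (C G) = N,
      forall (R : realType) (beta B : R) G,
        partition_function beta B G = \prod_(L <- C G) \tr (transfer_mx beta B ^+ L) &
      (\sum_G 3 ^ size (C G) = (2 * N + 1) * #|{: pairing (@degree2 N)}|)%N].
Proof.
have [C CP sC] := cycles_of_pairings 2 size_paths uniq_endseq_paths.
exists (fun G => C (val G)).
have GX (G : pairing (@degree2 N)) : val G \in pairings (endset vertex_paths).
  by rewrite endset_paths inE; exact: (valP G).
split=> [G|R beta B G|].
- by have [-> _] := CP _ (GX G); rewrite path_length_paths.
- have [_ CZ] := CP _ (GX G).
  have := CZ _ _ _ (edge_weight beta) (vertex_mx_sym B) (edge_mx_sym beta) (edge_weightE beta).
  rewrite -partition_function_paths size_endseq size_paths card_half_edge mulrC => /mulfI; apply.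
  by rewrite expf_neq0// pnatr_eq0.
rewrite (pairing_sum (fun G => 3 ^ size (C G))%N) -endset_paths sC -sum1_card.
rewrite (pairing_sum (fun=> 1%N)) sum1_card (@card_pairings _ N) ?cardsT ?card_half_edge//.
elim: N => [|n IH]; first by rewrite !big_ord0.
rewrite !big_ord_recr/= IH (_ : 2 * n + 3 = 2 * n.+1 + 1)%N; last by lia.
by rewrite [LHS]mulnC; congr muln; rewrite [LHS]mulnC addn1.
Qed.

Lemma card_pairing_gt0 : (0 < #|{: pairing (@degree2 N)}|)%N.
Proof.
rewrite -sum1_card (pairing_sum (fun=> 1%N)) sum1_card.
by rewrite (@card_pairings _ N) ?cardsT ?card_half_edge// prodn_gt0.
Qed.

End CycleStructure.

(** * Eigenvalues of the transfer matrix and derivatives of the pressure *)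

Section Eigenvalues.
Variable R : realType.
Implicit Types (beta b : R).

(** Both sides satisfy the linear recursion of order two that the
    Cayley-Hamilton theorem gives. *)
Lemma trace_exp2 (K : comNzRingType) (A : 'M[K]_2) (x y : K) :
 
  A 0 0 + A 1 1 = x + y -> A 0 0 * A 1 1 - A 0 1 * A 1 0 = x * y ->
  forall n, \tr (A ^+ n) = x ^+ n + y ^+ n.
Proof.
move=> tA dA.
have l01 : lift ord0 ord0 = 1 :> 'I_2 by exact: val_inj.
have CH : A *m A = (x + y) *: A - (x * y)%:M.
  rewrite -tA -dA.
  apply/matrixP => i j; rewrite !mxE !big_ord_recl !big_ord0.
  have P k : k = 0 \/ k = 1 :> 'I_2.
    by case: k => -[|[|//]] p; [left|right]; exact: val_inj.
  rewrite l01.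
  have [->|->] := P i; have [->|->] := P j; rewrite /= ?mulr1n ?mulr0n; ring.
(* The recursion has order two, so two consecutive powers are carried along. *)
suff H n : \tr (A ^+ n) = x ^+ n + y ^+ n /\ \tr (A ^+ n.+1) = x ^+ n.+1 + y ^+ n.+1.
  by move=> n; have [] := H n.
elim: n => [|n [IH1 IH2]]; first by rewrite !expr0 !expr1 mxtrace1 /mxtrace !big_ord_recl big_ord0 addr0 -tA l01.
split=> //.
have -> : A ^+ n.+2 = (x + y) *: A ^+ n.+1 - (x * y) *: A ^+ n.
  rewrite !exprS mulrA -[A * A]/(A *m A) CH mulrBl scalerAl.
  by rewrite -[_%:M * _]/(_ *m _) mul_scalar_mx.
rewrite raddfB /= !linearZ/= IH1 IH2 !exprS; ring.
Qed.

Definition lambda_minus beta b : R :=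
  expR beta * (cosh b - Num.sqrt (sinh b ^+ 2 + expR (- (4 * beta)))).

Lemma cosh2 b : cosh b ^+ 2 = 1 + sinh b ^+ 2.
Proof.
have := expRxMexpNx_1 b; rewrite /cosh /sinh => H.
have -> : ((expR b + expR (- b)) / 2) ^+ 2 = expR b * expR (- b) + ((expR b - expR (- b)) / 2) ^+ 2.
  by field.
by rewrite H.
Qed.

Lemma cosh_gt0 b : 0 < cosh b.
Proof. by rewrite divr_gt0// addr_gt0 ?expR_gt0. Qed.

Lemma disc_gt0 beta b : 0 < sinh b ^+ 2 + expR (- (4 * beta)).
Proof. by rewrite ltr_wpDl ?sqr_ge0// expR_gt0. Qed.

Lemma lambda_plus_gt0 beta b : 0 < lambda_plus beta b.
Proof. by rewrite mulr_gt0 ?expR_gt0// addr_gt0 ?cosh_gt0// sqrtr_gt0 disc_gt0. Qed.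

Lemma lambda_mul beta b :
  lambda_plus beta b * lambda_minus beta b = expR (2 * beta) - expR (- (2 * beta)).
Proof.
rewrite /lambda_plus /lambda_minus; set d := Num.sqrt _.
have d2 : d ^+ 2 = sinh b ^+ 2 + expR (- (4 * beta)) by rewrite sqr_sqrtr// ltW ?disc_gt0.
have -> : expR beta * (cosh b + d) * (expR beta * (cosh b - d)) =
   expR beta * expR beta * (cosh b ^+ 2 - d ^+ 2) by ring.
rewrite cosh2 d2 -expRD opprD addrA addrK mulrBr mulr1 -expRD.
by congr (expR _ - expR _); ring.
Qed.

Lemma trace_transfer beta b n :
  \tr (transfer_mx beta b ^+ n) = lambda_plus beta b ^+ n + lambda_minus beta b ^+ n.
Proof.
have E i j : transfer_mx beta b i j = expR (b * (-1) ^+ i) * expR (beta * ((-1) ^+ i * (-1) ^+ j)).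
  rewrite mxE (bigD1 i)//= big1 ?addr0; first by rewrite !mxE eqxx.
  by move=> k ki; rewrite !mxE eq_sym (negbTE ki) mul0r.
apply: trace_exp2.
  rewrite !E /lambda_plus /lambda_minus /cosh /=.
  by rewrite !expr1 !expr0 !mulr1 !mulrN1 ?mulr1 opprK ?mulr1; field.
rewrite !E lambda_mul /= expr0 expr1 -!expRD.
by congr (expR _ - expR _); ring.
Qed.

Definition pressure beta b : R := ln (lambda_plus beta b).

Definition magnetization beta b : R := sinh b / Num.sqrt (sinh b ^+ 2 + expR (- (4 * beta))).

(** The second derivative of the pressure, in the form that differentiation
    of the magnetization produces. *)
Definition chi1d beta b : R :=
  cosh b * expR (- (4 * beta)) / Num.sqrt (sinh b ^+ 2 + expR (- (4 * beta))) ^+ 3.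

Lemma is_derive_cosh b : is_derive b 1 (@cosh R) (sinh b).
Proof. by rewrite /cosh; apply: is_derive_eq; rewrite /GRing.scale/= /sinh; field. Qed.

Lemma is_derive_sinh b : is_derive b 1 (@sinh R) (cosh b).
Proof. by rewrite /sinh; apply: is_derive_eq; rewrite /GRing.scale/= /cosh; field. Qed.

Lemma is_derive_disc beta b :
  is_derive b 1 (fun b => Num.sqrt (sinh b ^+ 2 + expR (- (4 * beta))))
    (sinh b * cosh b / Num.sqrt (sinh b ^+ 2 + expR (- (4 * beta)))).
Proof.
have H : is_derive b 1 (fun b => sinh b ^+ 2 + expR (- (4 * beta))) (2 * sinh b * cosh b).
  have D := is_derive_sinh b.
  by apply: is_derive_eq; rewrite /GRing.scale/=; ring.
have S := is_derive1_sqrt (disc_gt0 beta b).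
have d0 := sqrtr_gt0 (sinh b ^+ 2 + expR (- (4 * beta))).
rewrite disc_gt0 in d0.
apply: (is_derive_eq (@is_derive1_comp R Num.sqrt (fun b => sinh b ^+ 2 + expR (- (4 * beta))) b _ _ S H)).
by field; rewrite gt_eqF.
Qed.

(** With d the square root of sinh(b)^2 + e^(-4 beta), the logarithmic
    derivative of cosh(b) + d is
    (sinh(b) + sinh(b) cosh(b) / d) / (cosh(b) + d) = sinh(b) / d. *)
Lemma is_derive_pressure beta b : is_derive b 1 (pressure beta) (magnetization beta b).
Proof.
have D := is_derive_disc beta b; have C := is_derive_cosh b.
have l0 := lambda_plus_gt0 beta b.
have H : is_derive b 1 (lambda_plus beta)
   (expR beta * (sinh b + sinh b * cosh b / Num.sqrt (sinh b ^+ 2 + expR (- (4 * beta))))).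
  by apply: is_derive_eq; rewrite /GRing.scale/=; ring.
apply: (is_derive_eq (@is_derive1_comp R (@ln R) (lambda_plus beta) b _ _ (is_derive1_ln l0) H)).
have d0 : 0 < Num.sqrt (sinh b ^+ 2 + expR (- (4 * beta))) by rewrite sqrtr_gt0 disc_gt0.
rewrite /magnetization /lambda_plus; field.
by rewrite !gt_eqF ?expR_gt0// addr_gt0// cosh_gt0.
Qed.

Lemma is_derive_magnetization beta b : is_derive b 1 (magnetization beta) (chi1d beta b).
Proof.
have D := is_derive_disc beta b; have C := is_derive_sinh b.
have d0 : 0 < Num.sqrt (sinh b ^+ 2 + expR (- (4 * beta))) by rewrite sqrtr_gt0 disc_gt0.
have V := @is_deriveV _ _ b _ 1 (lt0r_neq0 d0) D.
apply: (is_derive_eq (is_deriveM C V)).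
rewrite /GRing.scale/= /chi1d.
have d2 : Num.sqrt (sinh b ^+ 2 + expR (- (4 * beta))) ^+ 2 = sinh b ^+ 2 + expR (- (4 * beta)).
  by rewrite sqr_sqrtr// ltW ?disc_gt0.
have -> : expR (- (4 * beta)) = Num.sqrt (sinh b ^+ 2 + expR (- (4 * beta))) ^+ 2 - sinh b ^+ 2.
  by rewrite d2 addrC addKr.
rewrite [Num.sqrt (_ + (_ - _))](_ : _ = Num.sqrt (sinh b ^+ 2 + expR (- (4 * beta)))); last first.
  by rewrite d2; congr Num.sqrt; ring.
by field; rewrite gt_eqF.
Qed.

Lemma susceptibility_1dE beta b : susceptibility_1d beta b = chi1d beta b.
Proof.
rewrite /susceptibility_1d derive1nS derive1n1.
have -> : (fun b => ln (lambda_plus beta b))^`()%classic = magnetization beta.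
  by apply/funext => x; rewrite derive1E; apply: derive_val; exact: is_derive_pressure.
by rewrite derive1E; apply: derive_val; exact: is_derive_magnetization.
Qed.

Lemma chi1dE beta b : chi1d beta b =
  cosh b * expR (- (4 * beta)) / (sinh b ^+ 2 + expR (- (4 * beta))) `^ (3 / 2).
Proof.
rewrite /chi1d; congr (_ / _).
have w0 := disc_gt0 beta b.
by rewrite [3 / 2]mulrC powRrM powR12_sqrt ?(ltW w0)// powR_mulrn ?sqrtr_ge0.
Qed.

Lemma chi1d_gt0 beta b : 0 < chi1d beta b.
Proof.
apply: divr_gt0; first by rewrite mulr_gt0 ?cosh_gt0 ?expR_gt0.
by apply: exprn_gt0; rewrite sqrtr_gt0 disc_gt0.
Qed.

End Eigenvalues.

(** * Second-order expansions *)

Section Calculus.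
Variable R : realType.

Lemma is_derive_approx (f : R -> R) (x d : R) : is_derive x 1 f d ->
  forall e, 0 < e -> exists2 delta, 0 < delta &
    forall s, `|s| <= delta -> `|f (x + s) - f x - d * s| <= e * `|s|.
Proof.
move=> [df fd] e e0.
have cv : (fun h => h^-1 *: (f (h *: 1 + x) - f x)) @ 0^' --> d by rewrite -fd.
have /cvgrPdist_le/(_ e e0) := cv.
move=> /nbhs_ballP[r /= r0 rP]; exists (r / 2); first by rewrite divr_gt0.
move=> s sr; have [->|s0] := eqVneq s 0.
  by rewrite addr0 subrr mulr0 subr0 normr0 mulr0.
have /= := rP s; rewrite /ball/= sub0r normrN => H.
have {}H : `|d - s^-1 *: (f (s *: 1 + x) - f x)| <= e.
  apply: H => //; apply: le_lt_trans sr _.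
  by rewrite ltr_pdivrMr// ltr_pMr// ltr1n.
have -> : f (x + s) - f x - d * s = - (d - s^-1 *: (f (s *: 1 + x) - f x)) * s.
  by rewrite /GRing.scale/= mulr1 [s + x]addrC; field.
by rewrite normrM normrN ler_wpM2r.
Qed.

Lemma is_derive_lipschitz (f : R -> R) (x d : R) : is_derive x 1 f d ->
  exists2 delta, 0 < delta &
    forall s, `|s| <= delta -> `|f (x + s) - f x| <= (`|d| + 1) * `|s|.
Proof.
move=> /is_derive_approx/(_ 1 ltr01)[delta d0 H]; exists delta => // s /H Hs.
have -> : f (x + s) - f x = (f (x + s) - f x - d * s) + d * s by ring.
by rewrite (le_trans (ler_normD _ _))// mulrDl addrC normrM lerD.
Qed.

(** The derivative of the remainder y |-> f y - (its Taylor polynomial) is the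
    first-order remainder of m, hence at most e |s| between x and x + s; the mean
    value theorem turns this into e s^2. *)
Lemma taylor2 (f m : R -> R) (x c : R) :
  (forall y : R, is_derive y 1 f (m y)) -> is_derive x 1 m c ->
  forall e, 0 < e -> exists2 delta, 0 < delta &
    forall s, `|s| <= delta -> `|f (x + s) - f x - m x * s - c * s ^+ 2 / 2| <= e * s ^+ 2.
Proof.
move=> fm mc e e0; have [delta d0 H] := is_derive_approx mc e0.
exists delta => // s sd.
(* The remainder of f, seen as a function of the end point. *)
pose h y := f y - m x * (y - x) - c / 2 * (y - x) ^+ 2.
have dh (y : R) : is_derive y 1 h (m y - m x - c * (y - x)).
  have D := fm y.
  have -> : h = (fun y => f y - m x * (y - x) - c / 2 * (y - x) ^+ 2) by [].
  by apply: is_derive_eq; rewrite /GRing.scale/=; field.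
have ch a b : {within `[a, b], continuous h}.
  apply: derivable_within_continuous => y _.
  by have [] := dh y.
have key y : `|y - x| <= `|s| -> `|m y - m x - c * (y - x)| <= e * `|s|.
  move=> ys; have := H (y - x) (le_trans ys sd).
  rewrite (_ : x + (y - x) = y); last by ring.
  by move=> /le_trans; apply; rewrite ler_pM2l.
have -> : f (x + s) - f x - m x * s - c * s ^+ 2 / 2 = h (x + s) - h x.
  by rewrite /h subrr [x + s - x]addrAC subrr; ring.
have -> : e * s ^+ 2 = e * `|s| * `|s| by rewrite -mulrA -expr2 real_normK// num_real.
have [s0|s0] := leP 0 s.
  have [|y yI ->] := @MVT_segment R h (fun y => m y - m x - c * (y - x)) x (x + s) _ _ (ch _ _).
    by rewrite lerDl.
  rewrite [x + s - x]addrAC subrr add0r normrM ler_wpM2r// key//.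
  move: yI; rewrite in_itv/= => /andP[y1 y2].
  by rewrite !ger0_norm// ?subr_ge0//; lra.
have [|y yI E] := @MVT_segment R h (fun y => m y - m x - c * (y - x)) (x + s) x _ _ (ch _ _).
  by rewrite gerDl ltW.
rewrite distrC E opprD addrA subrr sub0r normrM normrN ler_wpM2r// key//.
move: yI; rewrite in_itv/= => /andP[y1 y2].
rewrite ler0_norm ?ltr0_norm//; lra.
Qed.

Lemma cvg_sqrt_natV : (Num.sqrt n%:R)^-1 @[n --> \oo] --> (0 : R).
Proof.
rewrite gtr0_cvgV0; last by near=> n; rewrite sqrtr_gt0 ltr0n; near: n; exact: nbhs_infty_gt.
apply/cvgryPge => A; near=> n.
have [A0|A0] := leP A 0; first by rewrite (le_trans A0)// sqrtr_ge0.
rewrite -[A]gtr0_norm// -sqrtr_sqr ler_wsqrtr//.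
near: n; exact: nbhs_infty_ger.
Unshelve. all: by end_near. Qed.

(** At the scale s = t / sqrt n, n times the second-order remainder tends
    to 0. *)
Lemma cvg_taylor2 (f m : R -> R) (x c t : R) :
  (forall y : R, is_derive y 1 f (m y)) -> is_derive x 1 m c ->
  n%:R * (f (x + t / Num.sqrt n%:R) - f x - m x * (t / Num.sqrt n%:R)) @[n --> \oo]
    --> c * t ^+ 2 / 2.
Proof.
move=> fm mc; apply/cvgrPdist_le => e e0.
have [|delta d0 H] := taylor2 fm mc (_ : 0 < e / (t ^+ 2 + 1)).
  by rewrite divr_gt0// ltr_wpDl// sqr_ge0.
near=> n.
have n0 : (0 < n)%N by near: n; exact: nbhs_infty_gt.
have sn0 : 0 < Num.sqrt n%:R :> R by rewrite sqrtr_gt0 ltr0n.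
pose s := t / Num.sqrt n%:R : R.
have s2 : n%:R * s ^+ 2 = t ^+ 2.
  by rewrite /s exprMn exprVn sqr_sqrtr// mulrCA divff ?mulr1// pnatr_eq0 -lt0n.
have sd : `|s| <= delta.
  have : `|0 - (Num.sqrt n%:R)^-1| <= delta / (`|t| + 1) :> R.
    near: n; move/cvgrPdist_le : cvg_sqrt_natV; apply.
    by rewrite divr_gt0// ltr_wpDl.
  rewrite sub0r normrN ler_pdivlMr ?ltr_wpDl// => Hd.
  by rewrite /s normrM mulrC (le_trans _ Hd)// ler_wpM2l// lerDl.
rewrite distrC.
have -> : n%:R * (f (x + t / Num.sqrt n%:R) - f x - m x * (t / Num.sqrt n%:R)) - c * t ^+ 2 / 2 =
   n%:R * (f (x + s) - f x - m x * s - c * s ^+ 2 / 2) by rewrite -s2 -/s; ring.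
rewrite normrM (@ger0_norm _ n%:R)//.
apply: (@le_trans _ _ (n%:R * (e / (t ^+ 2 + 1) * s ^+ 2))); first by rewrite ler_wpM2l// H.
rewrite mulrCA s2 mulrAC ler_pdivrMr; last by rewrite ltr_wpDl// sqr_ge0.
by rewrite ler_pM2l// lerDl.
Unshelve. all: by end_near. Qed.

End Calculus.

(** * Dependence of the cycle factors on the field *)

Section EigenRatio.
Variable R : realType.
Variable beta : R.
Hypothesis beta0 : 0 <= beta.

Definition eigen_ratio b : R := lambda_minus beta b / lambda_plus beta b.

Lemma eigen_ratio_itv b : 0 <= eigen_ratio b < 1.
Proof.
have l0 := lambda_plus_gt0 beta b.
have lm : 0 <= lambda_minus beta b.
  rewrite -(pmulr_rge0 _ l0) lambda_mul subr_ge0 ler_expR.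
  by apply: (@le_trans _ _ 0); rewrite ?oppr_le0 mulr_ge0.
rewrite /eigen_ratio divr_ge0//= ?(ltW l0)// ltr_pdivrMr// mul1r ltr_pM2l ?expR_gt0// ltrD2l.
by rewrite gtrN// sqrtr_gt0 disc_gt0.
Qed.

(** The product of the eigenvalues is the determinant, which does not depend
    on the field, so r is a constant times lambda_plus^(-2), that is
    exp(- 2 pressure). *)
Lemma derivable_eigen_ratio (b : R) : exists d : R, is_derive b 1 eigen_ratio d.
Proof.
have -> : eigen_ratio =
    (fun b => (expR (2 * beta) - expR (- (2 * beta))) * (expR \o (fun b => -2 * pressure beta b)) b).
  apply/funext => x; have l0 := lambda_plus_gt0 beta x.
  rewrite -(lambda_mul beta x) /eigen_ratio /pressure /= mulNr expRN mulr2n mulrDl mul1r expRD.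
  by rewrite lnK ?posrE//; field; rewrite gt_eqF.
have D := is_derive_pressure beta b.
have H : is_derive b 1 (fun b => -2 * pressure beta b) (-2 * magnetization beta b).
  by apply: is_derive_eq; rewrite /GRing.scale/=; ring.
have E := @is_derive1_comp R expR (fun b => -2 * pressure beta b) b _ _ (is_derive_expR _) H.
by eexists; apply: is_derive_eq.
Qed.

(** In the factorization of a^n - b^n, the terms are bounded by a geometric
    series, uniformly in n. *)
Lemma expX_dist_le (a b rho : R) n : 0 <= a <= rho -> 0 <= b <= rho -> rho < 1 ->
  `|a ^+ n - b ^+ n| <= `|a - b| / (1 - rho).
Proof.
move=> /andP[a0 ar] /andP[b0 br] r1; rewrite subrXX normrM ler_wpM2l//.
have r0 : 0 <= rho by exact: le_trans ar.
rewrite (le_trans (ler_norm_sum _ _ _))//.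
apply: (@le_trans _ _ (\sum_(i < n) rho ^+ i)).
  apply: ler_sum => i _; rewrite ger0_norm ?mulr_ge0 ?exprn_ge0//.
  rewrite -[leRHS]mul1r ler_pM ?exprn_ge0//.
    by rewrite exprn_ile1//; lra.
  by rewrite lerXn2r.
rewrite -div1r ler_pdivlMr ?subr_gt0// mulrC -opprB mulNr -subrX1 opprB.
by rewrite gerBl exprn_ge0.
Qed.

(** Since 1 + b^l >= 1, a uniform bound on |a^l - b^l| also bounds each
    quotient of factors; one exponential is paid per cycle. *)
Lemma prod_ratio_le (a b rho : R) (ls : seq nat) : 0 <= a <= rho -> 0 <= b <= rho -> rho < 1 ->
  \prod_(l <- ls) (1 + a ^+ l) <=
  expR (`|a - b| / (1 - rho) * (size ls)%:R) * \prod_(l <- ls) (1 + b ^+ l).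
Proof.
move=> ha hb r1; have /andP[a0 _] := ha; have /andP[b0 _] := hb.
elim: ls => [|l ls IH]; first by rewrite !big_nil mulr0 expR0 mulr1.
rewrite !big_cons /= -natr1 mulrDr mulr1 [X in expR X]addrC expRD mulrACA.
apply: ler_pM => //.
- by rewrite addr_ge0// exprn_ge0.
- by rewrite prodr_ge0// => k _; rewrite addr_ge0// exprn_ge0.
have Hd := expX_dist_le l ha hb r1.
set D := _ / _ in Hd *; have D0 : 0 <= D by rewrite divr_ge0// subr_ge0 ltW.
have b1 : 1 <= 1 + b ^+ l by rewrite lerDl exprn_ge0.
apply: (@le_trans _ _ ((1 + D) * (1 + b ^+ l))).
  have : D <= D * (1 + b ^+ l) by rewrite ler_peMr.
  by move: Hd; rewrite ler_norml; lra.
by rewrite ler_wpM2r ?expR_ge1Dx//; lra.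
Qed.

Lemma prod_eigen_ratio_near b : exists2 c, 0 <= c & exists2 delta, 0 < delta &
  forall s, `|s| <= delta -> forall ls : seq nat,
    \prod_(l <- ls) (1 + eigen_ratio (b + s) ^+ l) <=
      expR (c * `|s| * (size ls)%:R) * \prod_(l <- ls) (1 + eigen_ratio b ^+ l) /\
    \prod_(l <- ls) (1 + eigen_ratio b ^+ l) <=
      expR (c * `|s| * (size ls)%:R) * \prod_(l <- ls) (1 + eigen_ratio (b + s) ^+ l).
Proof.
have [d Dd] := derivable_eigen_ratio b.
have [delta d0 H] := is_derive_lipschitz Dd.
have /andP[r0 r1] := eigen_ratio_itv b.
(* Any bound strictly between r(b) and 1 would do; it holds near b by continuity. *)
pose rho := (1 + eigen_ratio b) / 2; have rho1 : rho < 1 by rewrite /rho; lra.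
have d1 : 0 < `|d| + 1 by rewrite ltr_wpDl.
exists ((`|d| + 1) / (1 - rho)); first by rewrite divr_ge0 ?subr_ge0 ?ltW.
exists (Num.min delta ((1 - eigen_ratio b) / 2 / (`|d| + 1))).
  by rewrite lt_min d0 !divr_gt0// subr_gt0.
move=> s; rewrite le_min => /andP[/H Hs]; rewrite ler_pdivlMr// => sd ls.
have hb : 0 <= eigen_ratio b <= rho by rewrite r0 /rho; lra.
have ha : 0 <= eigen_ratio (b + s) <= rho.
  have /andP[-> _] := eigen_ratio_itv (b + s).
  by move: Hs; rewrite ler_norml /rho; lra.
have mono x : x <= (`|d| + 1) * `|s| ->
    x / (1 - rho) * (size ls)%:R <= (`|d| + 1) / (1 - rho) * `|s| * (size ls)%:R.
  move=> xs; rewrite ler_wpM2r// [leRHS]mulrAC ler_wpM2r// invr_ge0 subr_ge0 ltW//.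
have pos x : 0 <= x -> 0 <= \prod_(l <- ls) (1 + x ^+ l).
  by move=> x0; rewrite prodr_ge0// => k _; rewrite addr_ge0// exprn_ge0.
split.
  apply: le_trans (prod_ratio_le ls ha hb rho1) _.
  by rewrite ler_wpM2r ?pos// ler_expR mono.
apply: le_trans (prod_ratio_le ls hb ha rho1) _.
rewrite ler_wpM2r ?pos//; first by have /andP[] := ha.
by rewrite ler_expR mono// distrC.
Qed.

Lemma partition_function_cycles N (C : pairing (@degree2 N) -> seq nat) G b :
  sumn (C G) = N ->
  partition_function beta b G = \prod_(L <- C G) \tr (transfer_mx beta b ^+ L) ->
  partition_function beta b G = lambda_plus beta b ^+ N * \prod_(L <- C G) (1 + eigen_ratio b ^+ L).
Proof.
move=> sN ->; rewrite -{1}sN; elim: (C G) => [|L ls IH]; first by rewrite !big_nil expr0 mulr1.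
rewrite !big_cons IH /= exprD mulrACA; congr (_ * _).
rewrite trace_transfer mulrDr mulr1 -exprMn /eigen_ratio mulrC divfK//.
by rewrite gt_eqF// lambda_plus_gt0.
Qed.

End EigenRatio.

(** * Functions of exponential type and positive functionals *)

Section ExponentialType.
Variable R : realType.
Implicit Types (f g : R -> R) (L : (R -> R) -> R).

(** This class contains the exponentials and is stable under products, and
    each of its members is integrable against any law with a finite Laplace
    transform. *)
Definition exponential_type f := measurable_fun [set: R] f /\
  exists a C, [/\ 0 <= a, 0 <= C & forall x, `|f x| <= C * expR (a * `|x|)].

Lemma exp_abs_le (a b x : R) : a <= b -> expR (a * `|x|) <= expR (b * `|x|).
Proof. by move=> ab; rewrite ler_expR ler_wpM2r. Qed.

Lemma exponential_typeD f g : exponential_type f -> exponential_type g ->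
  exponential_type (fun x => f x + g x).
Proof.
move=> [mf [a [C [a0 C0 Hf]]]] [mg [b [D [b0 D0 Hg]]]]; split.
  exact: measurable_funD.
exists (a + b), (C + D); split; [exact: addr_ge0 | exact: addr_ge0 | move=> x].
rewrite mulrDl (le_trans (ler_normD _ _))// lerD//.
  by rewrite (le_trans (Hf x))// ler_wpM2l// exp_abs_le// lerDl.
by rewrite (le_trans (Hg x))// ler_wpM2l// exp_abs_le// lerDr.
Qed.

Lemma exponential_typeM f g : exponential_type f -> exponential_type g ->
  exponential_type (fun x => f x * g x).
Proof.
move=> [mf [a [C [a0 C0 Hf]]]] [mg [b [D [b0 D0 Hg]]]]; split.
  exact: measurable_funM.
exists (a + b), (C * D); split; [exact: addr_ge0 | exact: mulr_ge0 | move=> x].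
by rewrite normrM mulrDl expRD mulrACA ler_pM.
Qed.

Lemma exponential_type_bounded f : measurable_fun [set: R] f ->
  (forall x, `|f x| <= 1) -> exponential_type f.
Proof.
move=> mf f1; split=> //; exists 0, 1; split=> // x.
by rewrite mul0r expR0 mulr1.
Qed.

Lemma exponential_type_cst (c : R) : exponential_type (fun=> c).
Proof.
split; first exact: measurable_cst.
by exists 0, `|c|; split=> // x; rewrite mul0r expR0 mulr1.
Qed.

Lemma exponential_type_exp (t : R) : exponential_type (fun x => expR (t * x)).
Proof.
split.
  by apply: measurableT_comp => //; exact: measurable_funM.
exists `|t|, 1; split=> // x; rewrite mul1r ger0_norm ?expR_ge0// ler_expR.
by rewrite -normrM ler_norm.
Qed.

Lemma exponential_type_id : exponential_type id.
Proof.
split => //; exists 1, 1; split=> // x; rewrite !mul1r.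
by rewrite (le_trans _ (expR_ge1Dx _))// lerDr.
Qed.

Lemma exponential_typeX f k : exponential_type f -> exponential_type (fun x => f x ^+ k).
Proof.
move=> ef; elim: k => [|k IH]; first exact: exponential_type_cst.
have -> : (fun x => f x ^+ k.+1) = (fun x => f x * f x ^+ k).
  by apply/funext => x; rewrite exprS.
exact: exponential_typeM.
Qed.

(** The common properties of a finite mean and of a Gaussian integral that
    the passage to the limit uses. *)
Definition expectation_like L :=
  [/\ forall f g, exponential_type f -> exponential_type g ->
        L (fun x => f x + g x) = L f + L g,
      forall c f, exponential_type f -> L (fun x => c * f x) = c * L f &
      forall f g, exponential_type f -> exponential_type g ->
        (forall x, f x <= g x) -> L f <= L g].

Lemma expectation_likeB L f g : expectation_like L -> exponential_type f ->
  exponential_type g -> L (fun x => f x - g x) = L f - L g.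
Proof.
move=> [LD LZ _] ef eg.
rewrite -mulN1r -LZ// -LD//; last exact/exponential_typeM/eg/exponential_type_cst.
by congr L; apply/funext => x; rewrite mulN1r.
Qed.

Lemma exponential_typeB f g : exponential_type f -> exponential_type g ->
  exponential_type (fun x => f x - g x).
Proof.
move=> ef eg; have -> : (fun x => f x - g x) = (fun x => f x + -1 * g x).
  by apply/funext => x; rewrite mulN1r.
exact/exponential_typeD/exponential_typeM/eg/exponential_type_cst.
Qed.

Lemma expectation_like_norm L f g : expectation_like L -> exponential_type f ->
  exponential_type g -> (forall x, `|f x| <= g x) -> `|L f| <= L g.
Proof.
move=> [LD LZ Lle] ef eg fg; rewrite ler_norml -mulN1r -LZ// !Lle//.
- by move=> x; rewrite (le_trans (ler_norm _)).
- exact/exponential_typeM/eg/exponential_type_cst.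
- by move=> x; rewrite mulN1r lerNl (le_trans _ (fg x))// -normrN ler_norm.
Qed.

(** A combination of exponentials that dominates exp(a |x|): its means converge
    when Laplace transforms do. *)
Definition weight (a x : R) := expR (a * x) + expR (- a * x).

Lemma exponential_type_weight a : exponential_type (weight a).
Proof. by apply: exponential_typeD; exact: exponential_type_exp. Qed.

Lemma exp_abs_weight (a x : R) : expR (a * `|x|) <= weight a x.
Proof.
rewrite /weight; have [x0|x0] := leP 0 x.
  by rewrite ger0_norm// lerDl expR_ge0.
by rewrite ltr0_norm// mulrN mulNr lerDr expR_ge0.
Qed.

End ExponentialType.

(** * Convergence of means: exponentials and weighted limits *)

Section LaplaceConvergence.
Variable R : realType.
Implicit Types (f g : R -> R).
Variables (Ln : nat -> (R -> R) -> R) (L : (R -> R) -> R).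
Hypotheses (expLn : forall n, expectation_like (Ln n)) (expL : expectation_like L).
Hypothesis laplace_cvg : forall t : R,
  Ln n (fun x => expR (t * x)) @[n --> \oo] --> L (fun x => expR (t * x)).

Definition mean_cvg f := exponential_type f /\ Ln n f @[n --> \oo] --> L f.

Lemma mean_cvgD f g : mean_cvg f -> mean_cvg g -> mean_cvg (fun x => f x + g x).
Proof.
move=> [ef cf] [eg cg]; split; first exact: exponential_typeD.
have [LD _ _] := expL; rewrite LD//.
under eq_fun => n do (have [LnD _ _] := expLn n; rewrite LnD//).
exact: cvgD.
Qed.

Lemma mean_cvgZ c f : mean_cvg f -> mean_cvg (fun x => c * f x).
Proof.
move=> [ef cf]; split; first exact/exponential_typeM/ef/exponential_type_cst.
have [_ LZ _] := expL; rewrite LZ//.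
under eq_fun => n do (have [_ LnZ _] := expLn n; rewrite LnZ//).
exact: cvgMr.
Qed.

Lemma mean_cvg_exp t : mean_cvg (fun x => expR (t * x)).
Proof. by split; [exact: exponential_type_exp | exact: laplace_cvg]. Qed.

Lemma mean_cvg_weight a : mean_cvg (weight a).
Proof. by apply: mean_cvgD; exact: mean_cvg_exp. Qed.

(** Approximation within e exp(a |x|), with a independent of e, preserves
    convergence of means since the means of the weight stay bounded.  The
    exponential types of the approximants themselves may be unbounded. *)
Lemma mean_cvg_limit f a : exponential_type f ->
  (forall e, 0 < e ->
     exists2 g, mean_cvg g & forall x, `|f x - g x| <= e * expR (a * `|x|)) ->
  mean_cvg f.
Proof.
move=> ef fapp; split=> //.
have [_ cW] := mean_cvg_weight a.
have eW := exponential_type_weight a.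
have LW0 : 0 <= L (weight a).
  apply: le_trans (@expectation_like_norm _ L (fun=> 0) (weight a) _ _ _ _) => //.
    exact: exponential_type_cst.
  by move=> x; rewrite normr0 addr_ge0// expR_ge0.
pose K := L (weight a) + 1.
have K0 : 0 < K by rewrite ltr_wpDl.
apply/cvgrPdist_le => e e0.
have [|g [eg cg] fg] := fapp (e / 3 / K); first by rewrite !divr_gt0.
have close L' : expectation_like L' -> L' (weight a) <= K -> `|L' f - L' g| <= e / 3.
  move=> eL' L'W; rewrite -expectation_likeB//.
  apply: le_trans (@expectation_like_norm _ L' _ (fun x => e / 3 / K * weight a x) _ _ _ _) _ => //.
  - exact: exponential_typeB.
  - exact/exponential_typeM/eW/exponential_type_cst.
  - move=> x; rewrite (le_trans (fg x))// ler_wpM2l ?exp_abs_weight//.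
    by rewrite !divr_ge0// ltW.
  have [_ L'Z _] := eL'; rewrite L'Z// -[leRHS](divfK (lt0r_neq0 K0)).
  by rewrite ler_wpM2l// !divr_ge0// ltW.
near=> n.
have nW : Ln n (weight a) <= K.
  suff : `|L (weight a) - Ln n (weight a)| <= 1 by rewrite ler_norml /K; lra.
  by near: n; move/cvgrPdist_le : cW; apply.
have ng : `|L g - Ln n g| <= e / 3.
  by near: n; move/cvgrPdist_le : cg; apply; rewrite divr_gt0.
have := close L expL; have := close (Ln n) (expLn n) nW.
rewrite lerDl ler01 => H1 /(_ isT) H2.
move: H1 H2 ng; rewrite !ler_norml; lra.
Unshelve. all: by end_near. Qed.

End LaplaceConvergence.

(** * Convergence of means: polynomials *)

Section Estimates.
Variable R : realType.

Lemma expR_sub1D_ge0 (y : R) : 0 <= expR y - 1 - y.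
Proof. by have := expR_ge1Dx y; lra. Qed.

(** The lower bound e^y >= 1 + y applied to y and to - y suffices: it gives
    e^y - 1 - y <= y (e^y - 1), which is at most y^2 e^y or y^2 according to
    the sign of y. *)
Lemma expR_remainder (y : R) : `|expR y - 1 - y| <= y ^+ 2 * expR `|y|.
Proof.
rewrite ger0_norm ?expR_sub1D_ge0//.
have e0 := expR_gt0 y.
have H : expR y * (1 - y) <= 1.
  have := expR_ge1Dx (- y); rewrite -(ler_pM2l e0) => /le_trans; apply.
  by rewrite -expRD subrr expR0.
have [y0|y0] := leP 0 y.
  rewrite (ger0_norm y0) expr2.
  have : y * (expR y * (1 - y)) <= y * 1 by rewrite ler_wpM2l.
  lra.
rewrite ltr0_norm//.
have : 1 <= expR (- y) by rewrite -[leLHS]expR0 ler_expR oppr_ge0 ltW.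
rewrite -(ler_pM2l (_ : 0 < y ^+ 2)); last by rewrite exprn_even_gt0//= lt_eqF.
rewrite mulr1; apply: le_trans.
have := expR_ge1Dx y; rewrite -(ler_nM2l y0) expr2; lra.
Qed.

Lemma pow_le_exp k (x : R) : `|x| ^+ k <= k`!%:R * expR `|x|.
Proof.
case: k => [|k]; first by rewrite expr0 fact0 mul1r -[leLHS]expR0 ler_expR.
rewrite mulrC -ler_pdivrMr ?ltr0n ?fact_gt0//.
by apply: le_trans (expR_ge1Dxn k (normr_ge0 x)); rewrite lerDr.
Qed.

(** The difference quotient in t of x^k exp(t x) converges to
    x^(k+1) exp(t x), uniformly with respect to an exponential weight. *)
Lemma diff_quotient_exp k (t h x : R) : h != 0 -> `|h| <= 1 ->
  `|h^-1 * (x ^+ k * expR ((t + h) * x) - x ^+ k * expR (t * x))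
    - x ^+ k.+1 * expR (t * x)| <=
  `|h| * ((k.+2)`!%:R * expR ((`|t| + 2) * `|x|)).
Proof.
move=> h0 h1.
have -> : h^-1 * (x ^+ k * expR ((t + h) * x) - x ^+ k * expR (t * x))
    - x ^+ k.+1 * expR (t * x) =
    h^-1 * (x ^+ k * (expR (t * x) * (expR (h * x) - 1 - h * x))).
  by rewrite mulrDl expRD exprS; field.
rewrite !normrM normfV.
apply: (@le_trans _ _ (`|h|^-1 * (`|x ^+ k| * (`|expR (t * x)| *
   ((h * x) ^+ 2 * expR `|h * x|))))).
  by rewrite !ler_wpM2l// ?invr_ge0//; exact: expR_remainder.
have -> : `|h|^-1 * (`|x ^+ k| * (`|expR (t * x)| * ((h * x) ^+ 2 * expR `|h * x|)))
   = `|h| * (`|x| ^+ k.+2 * (expR (t * x) * expR `|h * x|)).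
  rewrite (ger0_norm (expR_ge0 _)) exprMn -(real_normK (num_real h)) -(real_normK (num_real x)).
  rewrite normrX [in RHS]exprSr [in RHS]exprSr; field.
  by rewrite normr_eq0.
rewrite ler_wpM2l//.
apply: (@le_trans _ _ ((k.+2)`!%:R * expR `|x| * (expR (`|t| * `|x|) * expR `|x|))).
  rewrite ler_pM// ?mulr_ge0 ?expR_ge0 ?exprn_ge0 ?pow_le_exp//.
  rewrite ler_pM ?expR_ge0// ler_expR.
    by rewrite -normrM ler_norm.
  by rewrite normrM ler_piMl.
rewrite -mulrA ler_wpM2l// -!expRD ler_expR; lra.
Qed.

Lemma is_derive_of_bound (f : R -> R) (t d K : R) :
  (forall h, h != 0 -> `|h| <= 1 -> `|h^-1 * (f (t + h) - f t) - d| <= `|h| * K) ->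
  is_derive t 1 f d.
Proof.
move=> H.
have cv : (fun h => h^-1 *: (f (h *: 1 + t) - f t)) @ 0^' --> d.
  apply/cvgrPdist_le => e e0; near=> h.
  have h0 : h != 0 by near: h; exact: nbhs_dnbhs_neq.
  rewrite distrC /GRing.scale/= mulr1 [h + t]addrC.
  apply: le_trans (H h h0 _) _.
    near: h; apply: dnbhs0_le; exact: ltr01.
  have : `|h| <= e / (`|K| + 1).
    near: h; apply: dnbhs0_le; rewrite divr_gt0// ltr_wpDl//.
  rewrite ler_pdivlMr ?ltr_wpDl// => hK; apply: le_trans hK.
  by rewrite ler_wpM2l// (le_trans (ler_norm K))// lerDl.
split; first by apply/cvg_ex; exists d.
exact: cvg_lim cv.
Unshelve. all: by end_near. Qed.

Lemma exponential_type_powexp k (t : R) :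
  exponential_type (fun x => x ^+ k * expR (t * x)).
Proof.
apply: exponential_typeM; last exact: exponential_type_exp.
exact/exponential_typeX/exponential_type_id.
Qed.

(** Differentiation under the mean; it yields the moments of a law from its
    Laplace transform. *)
Lemma is_derive_laplace (L : (R -> R) -> R) : expectation_like L ->
  forall k (t : R), is_derive t 1 (fun t : R => L (fun x => x ^+ k * expR (t * x)))
                 (L (fun x => x ^+ k.+1 * expR (t * x))).
Proof.
move=> eL k t; have [_ LZ Lle] := eL.
pose W := fun x => (k.+2)`!%:R * weight (`|t| + 2) x.
apply: (@is_derive_of_bound _ _ _ (L W)) => h h0 h1.
have E := exponential_type_powexp.
have eW : exponential_type W.
  by apply: exponential_typeM; [exact: exponential_type_cst|exact: exponential_type_weight].
rewrite -expectation_likeB// -LZ//; last exact: exponential_typeB.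
have eZ : exponential_type
   (fun x => h^-1 * (x ^+ k * expR ((t + h) * x) - x ^+ k * expR (t * x))).
  by apply: exponential_typeM; [exact: exponential_type_cst|exact: exponential_typeB].
rewrite -expectation_likeB// -LZ//.
apply: expectation_like_norm => //; first exact: exponential_typeB.
  by apply: exponential_typeM => //; exact: exponential_type_cst.
move=> x; apply: le_trans (diff_quotient_exp k t x h0 h1) _.
by rewrite ler_wpM2l// /W ler_wpM2l// exp_abs_weight.
Qed.

(** Induction on k: x^(k+1) exp(t x) is a weighted limit of difference
    quotients of x^k exp(t x). *)
Lemma mean_cvg_powexp Ln L : (forall n : nat, @expectation_like R (Ln n)) -> expectation_like L ->
  (forall t : R, Ln n (fun x => expR (t * x)) @[n --> \oo] --> L (fun x => expR (t * x))) ->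
  forall k t, mean_cvg Ln L (fun x => x ^+ k * expR (t * x)).
Proof.
move=> eLn eL cv; elim=> [t|k IH t].
  have -> : (fun x : R => x ^+ 0 * expR (t * x)) = (fun x => expR (t * x)).
    by apply/funext => x; rewrite mul1r.
  exact: mean_cvg_exp.
apply: (@mean_cvg_limit _ _ _ eLn eL cv _ (`|t| + 2)); first exact: exponential_type_powexp.
move=> e e0; pose h := Num.min 1 (e / (k.+2)`!%:R).
have F0 : 0 < (k.+2)`!%:R :> R by rewrite ltr0n fact_gt0.
have h0 : 0 < h by rewrite lt_min ltr01 divr_gt0.
have h1 : `|h| <= 1 by rewrite (ger0_norm (ltW h0)) ge_min lexx.
exists (fun x => h^-1 * (x ^+ k * expR ((t + h) * x) + -1 * (x ^+ k * expR (t * x)))).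
  exact/mean_cvgZ/mean_cvgD/mean_cvgZ.
move=> x; rewrite mulN1r distrC; apply: le_trans (diff_quotient_exp k t x (lt0r_neq0 h0) h1) _.
rewrite mulrA ler_wpM2r ?expR_ge0// (ger0_norm (ltW h0)) -ler_pdivlMr//.
by rewrite /h ge_min lexx orbT.
Qed.

(** A tail of the exponential series at |y| is at most 2^(-n) times the same
    tail at 2 |y|, so the partial sums of cos and sin converge uniformly with
    respect to an exponential weight. *)
Lemma series_tail_le (u : R^nat) (y l : R) : (forall k, `|u k| <= exp_coeff `|y| k) ->
  series u @ \oo --> l -> forall n, `|l - series u n| <= (2^-1) ^+ n * expR (2 * `|y|).
Proof.
move=> uy ul n.
have cv : `|series u m - series u n| @[m --> \oo] --> `|l - series u n|.
  by apply: cvg_norm; apply: cvgB => //; exact: cvg_cst.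
rewrite -(cvg_lim (@norm_hausdorff _ _) cv); apply: limr_le; first by apply/cvg_ex; eexists; exact: cv.
near=> m; have nm : (n <= m)%N by near: m; exact: nbhs_infty_ge.
rewrite sub_series_geq// (le_trans (ler_norm_sum _ _ _))//.
apply: (@le_trans _ _ (\sum_(n <= k < m) (2^-1) ^+ n * exp_coeff (2 * `|y|) k)).
  rewrite big_nat [leRHS]big_nat; apply: ler_sum => k /andP[nk km].
  have y0 : 0 <= `|y| ^+ k / k`!%:R by rewrite divr_ge0// exprn_ge0.
  have n2 : 1 <= (2^-1 : R) ^+ n * 2 ^+ k.
    by rewrite exprVn ler_pdivlMl ?exprn_gt0// mulr1 ler_weXn2l// ler1n.
  apply: le_trans (uy k) _; rewrite /exp_coeff/= exprMn.
  by apply: le_trans (ler_peMl y0 n2) _; rewrite -!mulrA.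
rewrite -mulr_sumr ler_wpM2l ?exprn_ge0//.
apply: (@le_trans _ _ (series (exp_coeff (2 * `|y|)) m)).
  rewrite /series/= (@big_cat_nat _ _ _ n 0 m)//= lerDr sumr_ge0// => k _.
  by rewrite exp_coeff_ge0// mulr_ge0.
apply: nondecreasing_cvgn_le; last exact: is_cvg_series_exp_coeff.
apply/nondecreasing_seqP => k; rewrite /series/= big_nat_recr//= lerDl.
by rewrite exp_coeff_ge0// mulr_ge0.
Unshelve. all: by end_near. Qed.

End Estimates.

(** * Polynomials that approximate a step *)

Section Steepening.
Variable R : realType.

Lemma sin_nondecreasing (a b : R) : - (pi / 2) <= a -> b <= pi / 2 -> a <= b -> sin a <= sin b.
Proof.
move=> ha hb; rewrite le_eqVlt => /predU1P[->//|ab].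
by rewrite ltW// ltr_sin// in_itv/=; lra.
Qed.

Lemma bernoulli_ineq (z : R) n : -1 <= z -> 1 + n%:R * z <= (1 + z) ^+ n.
Proof.
move=> z1; elim: n => [|n IH]; first by rewrite mul0r addr0 expr0.
rewrite exprSr; apply: (@le_trans _ _ ((1 + n%:R * z) * (1 + z))).
  rewrite -natr1 -subr_ge0.
  have -> : (1 + n%:R * z) * (1 + z) - (1 + (n%:R + 1) * z) = n%:R * z ^+ 2 by ring.
  by rewrite mulr_ge0// sqr_ge0.
by rewrite ler_wpM2r//; lra.
Qed.

(** The polynomials (1 - u^m)^(2^m) map [0, 1] to itself and tend to 1 for
    u < 1/2 and to 0 for u > 1/2, at rates given by Bernoulli's inequality. *)
Definition steep (m : nat) (u : R) : R := (1 - u ^+ m) ^+ (2 ^ m).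

Lemma steep_itv m (u : R) : 0 <= u <= 1 -> 0 <= steep m u <= 1.
Proof.
move=> /andP[u0 u1]; have um0 := exprn_ge0 m u0; have um1 := exprn_ile1 m u0 u1.
by rewrite exprn_ge0 ?subr_ge0// exprn_ile1 ?subr_ge0// lerBlDr lerDl.
Qed.

Lemma steep_ge m (u : R) : 0 <= u <= 1 -> 1 - (2 * u) ^+ m <= steep m u.
Proof.
move=> /andP[u0 u1]; have um1 := exprn_ile1 m u0 u1.
have := @bernoulli_ineq (- u ^+ m) (2 ^ m).
by rewrite exprMn natrX mulrN; apply; rewrite lerN2.
Qed.

(** 1 + 2^m u^m <= (1 + u^m)^(2^m), and (1 - z)(1 + z) <= 1. *)
Lemma steep_le m (u s : R) : 0 <= u <= 1 -> 0 <= s -> 1 + s <= 2 * u ->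
  steep m u <= (1 + s)^-1 ^+ m.
Proof.
move=> /andP[u0 u1] s0 su.
have um0 := exprn_ge0 m u0; have um1 := exprn_ile1 m u0 u1.
have s1 : 0 < 1 + s by lra.
rewrite exprVn -[leRHS]mul1r ler_pdivlMr ?exprn_gt0//.
apply: (@le_trans _ _ (steep m u * (1 + u ^+ m) ^+ (2 ^ m))).
  rewrite ler_wpM2l//; first by have /andP[] := @steep_itv m u ltac:(by rewrite u0 u1).
  apply: le_trans (bernoulli_ineq _ _); last by apply: le_trans um0; rewrite lerN10.
  rewrite natrX -exprMn.
  apply: (@le_trans _ _ ((2 * u) ^+ m)); last by rewrite lerDr.
  by rewrite lerXn2r ?nnegrE//; lra.
rewrite -exprMn exprn_ile1//.
  by rewrite mulr_ge0//; lra.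
have -> : (1 - u ^+ m) * (1 + u ^+ m) = 1 - (u ^+ m) ^+ 2 by ring.
by rewrite lerBlDr lerDl sqr_ge0.
Qed.

End Steepening.

Definition ind_le (R : realType) (y x : R) : R := (x <= y)%R%:R.

(** * From Laplace transforms to distribution functions *)

Section CdfConvergence.
Variable R : realType.
Implicit Types (f g : R -> R).
Variables (Ln : nat -> (R -> R) -> R) (L : (R -> R) -> R).
Hypotheses (expLn : forall n, expectation_like (Ln n)) (expL : expectation_like L).
Hypothesis laplace_cvg : forall t : R,
  Ln n (fun x => expR (t * x)) @[n --> \oo] --> L (fun x => expR (t * x)).

Let converging := mean_cvg Ln L.

Lemma mean_cvg_pow k : converging (fun x => x ^+ k).
Proof.
have := mean_cvg_powexp expLn expL laplace_cvg k 0; rewrite -/converging.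
by under eq_fun do rewrite mul0r expR0 mulr1.
Qed.

Lemma mean_cvg_polynomial (a : nat -> R) n : converging (fun x => \sum_(0 <= k < n) a k * x ^+ k).
Proof.
elim: n => [|n IH].
  have := mean_cvgZ expLn expL 0 (mean_cvg_pow 0); rewrite -/converging.
  by under eq_fun do rewrite mul0r; under [X in _ -> converging X]eq_fun do rewrite big_nil.
under eq_fun do rewrite big_nat_recr//=.
exact/mean_cvgD/mean_cvgZ/mean_cvg_pow.
Qed.

(** The partial sums of the power series are polynomials, and
    [series_tail_le] controls the error by a weight that does not depend on
    the order of truncation. *)
Lemma mean_cvg_entire (u : R -> R^nat) (f : R -> R) (a : nat -> R) :
  (forall x, `|f x| <= 1) -> measurable_fun [set: R] f ->
  (forall y k, u y k = a k * y ^+ k) -> (forall y k, `|u y k| <= exp_coeff `|y| k) ->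
  (forall y, series (u y) @ \oo --> f y) ->
  forall c, converging (fun x => f (c * x)).
Proof.
move=> f1 mf ua ue uf c; apply: (@mean_cvg_limit _ _ _ expLn expL laplace_cvg _ (2 * `|c|)).
  apply: exponential_type_bounded => //.
  by apply: measurableT_comp => //; exact: measurable_funM.
move=> e e0.
have [n ne] : exists n, (2^-1 : R) ^+ n <= e.
  have /cvgrPdist_le/(_ e e0)[n _ /(_ n (leqnn n))] := @cvg_expr R 2^-1 ltac:(rewrite ger0_norm; lra).
  by rewrite sub0r normrN => He; exists n; apply: le_trans He; exact: ler_norm.
exists (fun x => series (u (c * x)) n).
  rewrite /series/=; under eq_fun do under eq_bigr do rewrite ua exprMn mulrA.
  exact: mean_cvg_polynomial.
move=> x; apply: le_trans (@series_tail_le R (u (c * x)) (c * x) _ (ue _) (uf _) n) _.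
by rewrite normrM mulrA ler_wpM2r// expR_ge0.
Qed.

Lemma mean_cvg_cos c d : converging (fun x => cos (c * x + d)).
Proof.
have Hc : converging (fun x => cos (c * x)).
  apply: (@mean_cvg_entire (@cos_coeff R) _ (fun k => (~~ odd k)%:R * (-1) ^+ k./2 / k`!%:R)).
  - exact: cos_max.
  - by apply: continuous_measurable_fun; exact: continuous_cos.
  - by move=> y k; rewrite /cos_coeff /= mulrAC.
  - move=> y k; rewrite /cos_coeff /exp_coeff /= !normrM normfV normrX normrX normrN1 expr1n.
    rewrite mulr1 [`|k`!%:R|]ger0_norm// ler_wpM2r ?invr_ge0// ler_piMl ?exprn_ge0//.
    by case: odd; rewrite /= ?normr0 ?normr1.
  - by move=> y; rewrite unlock; exact: is_cvg_series_cos_coeff.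
have Hs : converging (fun x => sin (c * x)).
  apply: (@mean_cvg_entire (@sin_coeff R) _ (fun k => (odd k)%:R * (-1) ^+ k.-1./2 / k`!%:R)).
  - exact: sin_max.
  - by apply: continuous_measurable_fun; exact: continuous_sin.
  - by move=> y k; rewrite /sin_coeff /= mulrAC.
  - move=> y k; rewrite /sin_coeff /exp_coeff /= !normrM normfV normrX normrX normrN1 expr1n.
    rewrite mulr1 [`|k`!%:R|]ger0_norm// ler_wpM2r ?invr_ge0// ler_piMl ?exprn_ge0//.
    by case: odd; rewrite /= ?normr0 ?normr1.
  - by move=> y; rewrite unlock; exact: is_cvg_series_sin_coeff.
have -> : (fun x => cos (c * x + d)) = (fun x => cos d * cos (c * x) + - sin d * sin (c * x)).
  by apply/funext => x; rewrite cosD; ring.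
by apply: mean_cvgD => //; exact: mean_cvgZ.
Qed.

(** Trigonometric polynomials are handled without a normal form: a multiplier
    preserves the functions f such that the means of f times any cosine
    converge.  Multipliers obviously form an algebra, and cosines belong to it
    by the formula for cos p cos q. *)
Definition trig_stable f := forall c d, converging (fun x => f x * cos (c * x + d)).

Definition multiplier g := forall f, trig_stable f -> trig_stable (fun x => f x * g x).

Lemma multiplier_cos a b : multiplier (fun x => cos (a * x + b)).
Proof.
move=> f sf c d.
have -> : (fun x => f x * cos (a * x + b) * cos (c * x + d)) =
   (fun x => 2^-1 * (f x * cos ((a + c) * x + (b + d)) + f x * cos ((a - c) * x + (b - d)))).
  apply/funext => x.
  have -> : (a + c) * x + (b + d) = (a * x + b) + (c * x + d) by ring.
  have -> : (a - c) * x + (b - d) = (a * x + b) - (c * x + d) by ring.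
  by move: (a * x + b) (c * x + d) => p q; rewrite cosD cosB; field.
by apply: mean_cvgZ => //; apply: mean_cvgD => //; exact: sf.
Qed.

Lemma multiplier_cst a : multiplier (fun=> a).
Proof.
move=> f sf c d.
have -> : (fun x => f x * a * cos (c * x + d)) = (fun x => a * (f x * cos (c * x + d))).
  by apply/funext => x; ring.
by apply: mean_cvgZ => //; exact: sf.
Qed.

Lemma multiplierD g h : multiplier g -> multiplier h -> multiplier (fun x => g x + h x).
Proof.
move=> mg mh f sf c d.
have -> : (fun x => f x * (g x + h x) * cos (c * x + d)) =
   (fun x => f x * g x * cos (c * x + d) + f x * h x * cos (c * x + d)).
  by apply/funext => x; ring.
by apply: mean_cvgD => //; [exact: mg|exact: mh].
Qed.

Lemma multiplierM g h : multiplier g -> multiplier h -> multiplier (fun x => g x * h x).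
Proof.
move=> mg mh f sf; under eq_fun do rewrite mulrA.
exact/mh/mg.
Qed.

Lemma multiplierX g n : multiplier g -> multiplier (fun x => g x ^+ n).
Proof.
move=> mg; elim: n => [|n IH]; first exact: multiplier_cst.
by under eq_fun do rewrite exprS; exact: multiplierM.
Qed.

Lemma mean_cvg_multiplier g : multiplier g -> converging g.
Proof.
move=> mg; have s1 : trig_stable (fun=> 1).
  by move=> c d; under eq_fun do rewrite mul1r; exact: mean_cvg_cos.
have := mg _ s1 0 0.
by under eq_fun do rewrite mul1r mul0r addr0 cos0 mulr1.
Qed.

Lemma mean_cvg_steep m c z : converging (fun x => steep m ((1 + sin (c * (x - z))) / 2)).
Proof.
apply: mean_cvg_multiplier; apply: multiplierX.
have -> : (fun x => 1 - ((1 + sin (c * (x - z))) / 2) ^+ m) =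
   (fun x => 1 + -1 * ((1 + cos (c * x + (- c * z - pi / 2))) * 2^-1) ^+ m).
  apply/funext => x; rewrite mulN1r; congr (1 - ((1 + _) * _) ^+ _).
  by rewrite addrA cosBpihalf; congr sin; ring.
apply: multiplierD; first exact: multiplier_cst.
apply: multiplierM; first exact: multiplier_cst.
apply: multiplierX; apply: multiplierM; last exact: multiplier_cst.
by apply: multiplierD; [exact: multiplier_cst|exact: multiplier_cos].
Qed.

(** The indicator of a half-line is bracketed, up to a small multiple of the
    weight, by a trigonometric polynomial: [steep] composed with
    (1 + sin(c (x - z))) / 2, where z is the middle of [y, y + e].  The
    frequency c is so small that beyond a quarter of a period the weight alone
    exceeds 1 / eta, and a power m is then chosen for the remaining points. *)
Lemma steep_sandwich (y e eta : R) : 0 < e -> 0 < eta ->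
  exists2 f, converging f & forall x : R, ind_le y x - eta * weight 1 x <= f x
                            <= ind_le (y + e) x + eta * weight 1 x.
Proof.
move=> e0 eta0; pose z := y + e / 2; pose A := `|z| + `|ln eta| + e.
have A0 : 0 < A by rewrite ltr_wpDl// addr_ge0.
pose c := A^-1; have c0 : 0 < c by rewrite invr_gt0.
have pi2 := pi_ge2 R.
have ce : c * e <= 1.
  by rewrite mulrC ler_pdivrMr// mul1r lerDr addr_ge0.
have ce0 : 0 < c * e by rewrite mulr_gt0.
pose s := sin (c * e / 2).
have s0 : 0 < s by apply: sin_gt0_pihalf; lra.
have [m Hm] : exists m, (1 + s)^-1 ^+ m <= eta.
  have q1 : `|(1 + s)^-1| < 1.
    by rewrite normfV ger0_norm ?invf_lt1//; lra.
  have /cvgrPdist_le/(_ eta eta0)[n _ /(_ n (leqnn n))] := cvg_expr q1.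
  by rewrite sub0r normrN => He; exists n; apply: le_trans He; exact: ler_norm.
pose u x := (1 + sin (c * (x - z))) / 2.
have u01 x : 0 <= u x <= 1.
  by have := sin_geN1 (c * (x - z)); have := sin_le1 (c * (x - z)); rewrite /u; lra.
exists (fun x => steep m (u x)); first exact: mean_cvg_steep.
move=> x; rewrite /ind_le; have f01 := steep_itv m (u01 x).
have W1 : 1 <= weight 1 x.
  apply: le_trans (exp_abs_weight 1 x); rewrite -[leLHS]expR0 ler_expR mul1r//.
(* Far from z the weight alone dominates every function with values in [0, 1]. *)
have far : A <= `|x - z| -> 1 <= eta * weight 1 x.
  move=> xz; apply: (@le_trans _ _ (eta * expR `|x|)); last first.
    by rewrite ler_pM2l// -[`|x|]mul1r exp_abs_weight.
  rewrite -{1}(@lnK _ eta) ?posrE// -expRD -[leLHS]expR0 ler_expR.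
  have := ler_norm (- ln eta); rewrite normrN.
  have := ler_normB x z; move: xz; rewrite /A; lra.
have eW : eta <= eta * weight 1 x by rewrite ler_peMr// ltW.
(* Outside a quarter of a period around z, the point x is far from z. *)
have farp : pi / 2 < `|c * (x - z)| -> A <= `|x - z|.
  rewrite normrM (ger0_norm (ltW c0)) [c * _]mulrC ltr_pdivlMr// => H.
  by apply: ltW; apply: le_lt_trans H; rewrite ler_peMl ?(ltW A0)//; lra.
have [xy|yx] := leP x y.
  have xye : x <= y + e by lra.
  rewrite xye /=; apply/andP; split; first last.
    by lra.
  have [far'|near'] := ltP (pi / 2) `|c * (x - z)|.
    have := far (farp far'); lra.
  apply: le_trans (steep_ge m (u01 x)); rewrite lerB// (le_trans _ eW)//.
  apply: le_trans Hm.
  have cx : c * (x - z) <= - (c * e / 2).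
    have -> : - (c * e / 2) = c * (- (e / 2)) by ring.
    by rewrite ler_pM2l// /z; lra.
  have sx : sin (c * (x - z)) <= - s.
    rewrite /s -sinN; move: near'; rewrite ler_norml => near'.
    by apply: sin_nondecreasing => //; lra.
  have u1 : 2 * u x <= 1 - s by rewrite /u; lra.
  have := u01 x => /andP[ux0 _].
  apply: (@le_trans _ _ ((1 - s) ^+ m)).
    by rewrite lerXn2r ?nnegrE//; lra.
  have s1 : s <= 1 by exact: sin_le1.
  rewrite lerXn2r ?nnegrE ?invr_ge0//; [lra|lra|].
  rewrite -[leRHS]mul1r ler_pdivlMr; last by lra.
  have -> : (1 - s) * (1 + s) = 1 - s ^+ 2 by ring.
  by have := sqr_ge0 s; lra.
have [xye|yex] := leP x (y + e).
  by apply/andP; split; rewrite /=; lra.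
apply/andP; split; first by rewrite /=; lra.
rewrite /= add0r.
have [far'|near'] := ltP (pi / 2) `|c * (x - z)|.
  have := far (farp far'); lra.
rewrite (le_trans _ eW)// (le_trans _ Hm)// steep_le ?(ltW s0)//.
have cx : c * e / 2 <= c * (x - z).
  by rewrite -mulrA ler_pM2l// /z; lra.
have sx : s <= sin (c * (x - z)).
  move: near'; rewrite ler_norml => near'.
  by apply: sin_nondecreasing => //; lra.
by rewrite /u; lra.
Qed.

Lemma exponential_type_ind_le (y : R) : exponential_type (ind_le y).
Proof.
apply: exponential_type_bounded; last by move=> x; rewrite /ind_le; case: (leP x y); rewrite /= ?normr0 ?normr1.
have -> : ind_le y = \1_(`]-oo, y]%classic : set R).
  apply/funext => x; rewrite /ind_le indicE; congr (_%:R); congr nat_of_bool.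
  by apply/idP/idP; rewrite inE/= in_itv//=.
exact: measurable_indic.
Qed.

(** Curtiss's theorem: the steps at y - d and y are separated by one function
    with convergent means, those at y and y + d by another one. *)
Theorem laplace_cvg_cdf (y : R) :
  {for y, continuous (fun y => L (ind_le y))} ->
  Ln n (ind_le y) @[n --> \oo] --> L (ind_le y).
Proof.
move=> cF; have [_ cW] := mean_cvg_weight expLn expL laplace_cvg 1.
have eW := exponential_type_weight (1 : R).
have eS := exponential_type_ind_le.
apply/cvgrPdist_le => e e0.
have [d d0 Hd] : exists2 d, 0 < d & forall y', `|y - y'| <= d ->
    `|L (ind_le y) - L (ind_le y')| <= e / 4.
  have /cvgrPdist_le/(_ (e / 4)) := cF; rewrite divr_gt0// => /(_ isT).
  rewrite near_simpl/= => /nbhs_ballP[d /= d0 dP]; exists (d / 2); first by rewrite divr_gt0.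
  move=> y' yy'; apply: dP; rewrite /ball/=.
  by apply: le_lt_trans yy' _; rewrite ltr_pdivrMr// ltr_pMr// ltr1n.
pose K := `|L (weight 1)| + 1; have K0 : 0 < K by rewrite ltr_wpDl.
pose eta := e / 4 / K; have eta0 : 0 < eta by rewrite !divr_gt0.
have etaK : eta * K = e / 4 by rewrite divfK// lt0r_neq0.
have eEW : exponential_type (fun x => eta * weight 1 x).
  exact/exponential_typeM/eW/exponential_type_cst.
have upper L' f y' : expectation_like L' -> exponential_type f -> L' (weight 1) <= K ->
    (forall x : R, f x <= ind_le y' x + eta * weight 1 x) -> L' f <= L' (ind_le y') + e / 4.
  move=> eL' ef L'K H; have [L'D L'Z L'le] := eL'.
  apply: (le_trans (L'le _ _ ef (exponential_typeD (eS y') eEW) H)).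
  by rewrite L'D// L'Z// lerD2l -etaK ler_pM2l.
have lower L' f y' : expectation_like L' -> exponential_type f -> L' (weight 1) <= K ->
    (forall x : R, ind_le y' x - eta * weight 1 x <= f x) -> L' (ind_le y') - e / 4 <= L' f.
  move=> eL' ef L'K H; have [L'D L'Z L'le] := eL'.
  apply: le_trans _ (L'le _ _ (exponential_typeB (eS y') eEW) ef H).
  by rewrite expectation_likeB// L'Z// lerD2l lerN2 -etaK ler_pM2l.
have LK : L (weight 1) <= K by rewrite (le_trans (ler_norm _))// lerDl.
have [f1 [ef1 cf1] Hf1] := steep_sandwich y d0 eta0.
have [f2 [ef2 cf2] Hf2] := steep_sandwich (y - d) d0 eta0.
have U1 : L f1 <= L (ind_le (y + d)) + e / 4.
  by apply: upper => // x; have /andP[] := Hf1 x.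
have U2 : L (ind_le (y - d)) - e / 4 <= L f2.
  by apply: lower => // x; have /andP[] := Hf2 x.
have D1 := Hd (y + d) ltac:(by rewrite opprD addrA subrr sub0r normrN gtr0_norm).
have D2 := Hd (y - d) ltac:(by rewrite opprB addrC subrK gtr0_norm).
near=> n.
have nK : Ln n (weight 1) <= K.
  suff : `|L (weight 1) - Ln n (weight 1)| <= 1.
    by have := ler_norm (L (weight 1)); rewrite ler_norml /K; lra.
  by near: n; move/cvgrPdist_le : cW; apply.
have n1 : `|L f1 - Ln n f1| <= e / 4.
  by near: n; move/cvgrPdist_le : cf1; apply; rewrite divr_gt0.
have n2 : `|L f2 - Ln n f2| <= e / 4.
  by near: n; move/cvgrPdist_le : cf2; apply; rewrite divr_gt0.
have V1 : Ln n (ind_le y) - e / 4 <= Ln n f1.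
  by apply: lower => // x; have /andP[] := Hf1 x.
have V2 : Ln n f2 <= Ln n (ind_le y) + e / 4.
  by apply: upper => // x; have /andP[_] := Hf2 x; rewrite subrK.
move: D1 D2 n1 n2; rewrite !ler_norml; lra.
Unshelve. all: by end_near. Qed.

End CdfConvergence.

(** * The Gaussian functional *)

Section Gaussian.
Variable R : realType.
Variable s : R.
Hypothesis s0 : s != 0.
Local Notation mu := (@lebesgue_measure R).
Local Notation g := (normal_pdf 0 s).

(** The density is used instead of the measure it defines, so that
    Lebesgue integration applies directly. *)
Definition gaussian_mean (f : R -> R) : R := \int[mu]_x (f x * g x).

(** Completing the square: an exponential tilt of a centered Gaussian is a
    translated Gaussian. *)
Lemma exp_normal_pdf (t x : R) :
  expR (t * x) * g x = expR (s ^+ 2 * t ^+ 2 / 2) * normal_pdf (s ^+ 2 * t) s x.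
Proof.
have E : t * x + - (x - 0) ^+ 2 / (s ^+ 2 *+ 2) =
    s ^+ 2 * t ^+ 2 / 2 + - (x - s ^+ 2 * t) ^+ 2 / (s ^+ 2 *+ 2).
  have : s ^+ 2 != 0 by rewrite expf_neq0.
  by move: (s ^+ 2) => v v0; rewrite -mulr_natr; field.
by rewrite !normal_pdfE// /normal_fun mulrCA -expRD E expRD mulrCA.
Qed.

Lemma integrable_exp_pdf (t : R) :
  mu.-integrable [set: R] (EFin \o (fun x => expR (t * x) * g x)).
Proof.
have -> : (fun x => expR (t * x) * g x) =
   (fun x => expR (s ^+ 2 * t ^+ 2 / 2) * normal_pdf (s ^+ 2 * t) s x).
  by apply/funext => x; exact: exp_normal_pdf.
have -> : EFin \o (fun x => expR (s ^+ 2 * t ^+ 2 / 2) * normal_pdf (s ^+ 2 * t) s x) =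
  (fun x => (expR (s ^+ 2 * t ^+ 2 / 2))%:E * (normal_pdf (s ^+ 2 * t) s x)%:E)%E.
  by apply/funext => x; rewrite /= EFinM.
by apply: integrableZl => //; exact: integrable_normal_pdf.
Qed.

Lemma gaussian_mean_exp (t : R) :
  gaussian_mean (fun x => expR (t * x)) = expR (s ^+ 2 * t ^+ 2 / 2).
Proof.
rewrite /gaussian_mean (@eq_Rintegral _ _ _ mu setT (fun x => expR (s ^+ 2 * t ^+ 2 / 2) * normal_pdf (s ^+ 2 * t) s x)).
  rewrite RintegralZl//; last exact: integrable_normal_pdf.
  by rewrite /Rintegral integral_normal_pdf/= mulr1.
by move=> x _; exact: exp_normal_pdf.
Qed.

Lemma integrable_pdf f : exponential_type f ->
  mu.-integrable [set: R] (EFin \o (fun x => f x * g x)).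
Proof.
move=> [mf [a [C [a0 C0 Hf]]]].
have iW : mu.-integrable [set: R] (EFin \o (fun x => C * (expR (a * x) * g x + expR (- a * x) * g x))).
  rewrite (_ : _ \o _ = (fun x => C%:E * ((expR (a * x) * g x)%:E + (expR (- a * x) * g x)%:E))%E).
    apply: integrableZl => //; apply: integrableD => //; exact: integrable_exp_pdf.
  by apply/funext => x; rewrite /= EFinM.
apply: le_integrable iW => //.
  apply/measurable_EFinP; apply: measurable_funM => //; exact: measurable_normal_pdf.
move=> x _; rewrite /= lee_fin normrM [`|g x|]ger0_norm ?normal_pdf_ge0//.
rewrite [leRHS]ger0_norm; last first.
  by apply: mulr_ge0 => //; apply: addr_ge0; apply: mulr_ge0; rewrite ?expR_ge0 ?normal_pdf_ge0.
rewrite -mulrDl mulrA ler_wpM2r ?normal_pdf_ge0// (le_trans (Hf x))// ler_wpM2l//.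
exact: exp_abs_weight.
Qed.

Lemma expectation_like_gaussian : expectation_like gaussian_mean.
Proof.
split.
- move=> f h ef eh; rewrite /gaussian_mean -RintegralD//; try exact: integrable_pdf.
  by apply: eq_Rintegral => x _; rewrite mulrDl.
- move=> c f ef; rewrite /gaussian_mean -RintegralZl//; last exact: integrable_pdf.
  by apply: eq_Rintegral => x _; rewrite mulrA.
- move=> f h ef eh fh; apply: le_Rintegral => //; try exact: integrable_pdf.
  by move=> x _; rewrite ler_wpM2r ?normal_pdf_ge0.
Qed.

Lemma gaussian_mean_ind_le (y : R) :
  gaussian_mean (ind_le y) = fine (normal_prob 0 s `]-oo, y]%classic).
Proof.
rewrite /gaussian_mean /normal_prob /Rintegral; congr fine.
rewrite [RHS]integral_mkcond; apply: eq_integral => x _.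
rewrite patchE /ind_le; case: (boolP (x <= y)%R) => xy.
  by rewrite mem_set /= ?mul1r// in_itv.
by rewrite memNset /= ?mul0r// in_itv/=; exact/negP.
Qed.

Lemma gaussian_mean_moments : gaussian_mean id = 0 /\ gaussian_mean (fun x => x ^+ 2) = s ^+ 2.
Proof.
(* The k-th derivative of the Gaussian Laplace transform. *)
pose phi k t := gaussian_mean (fun x => x ^+ k * expR (t * x)).
have dphi k (t : R) : is_derive t 1 (phi k) (phi k.+1 t).
  exact: is_derive_laplace expectation_like_gaussian k t.
have phi0 : phi 0%N = expR \o (fun t => (s ^+ 2 / 2) * t ^+ 2).
  apply/funext => t; rewrite /phi; under eq_fun do rewrite mul1r.
  by rewrite gaussian_mean_exp /= mulrAC.
have dsq (t : R) : is_derive t 1 (fun t : R => (s ^+ 2 / 2) * t ^+ 2) (s ^+ 2 * t).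
  by apply: is_derive_eq; rewrite /GRing.scale/=; field.
have phi1 : phi 1%N = (fun t => (s ^+ 2 * t) * expR (s ^+ 2 / 2 * t ^+ 2)).
  apply/funext => t; rewrite -(@derive_val _ _ _ _ _ _ _ (dphi 0%N t)) phi0.
  by rewrite (@derive_val _ _ _ _ _ _ _ (is_derive1_comp _ _)) mulrC.
have phi2 : phi 2%N 0 = s ^+ 2.
  rewrite -(@derive_val _ _ _ _ _ _ _ (dphi 1%N 0)) phi1.
  apply: derive_val; apply: is_derive_eq.
  rewrite /GRing.scale/= expr0n/= !mulr0 expR0; ring.
split.
  have := congr1 (fun f => f 0) phi1; rewrite /phi mulr0 mul0r => <-; congr gaussian_mean.
  by apply/funext => x; rewrite mul0r expR0 mulr1 expr1.
rewrite -phi2; congr gaussian_mean.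
by apply/funext => x; rewrite mul0r expR0 mulr1.
Qed.

End Gaussian.

(** * A central limit theorem from Laplace transforms *)

Section CentralLimit.
Variable R : realType.

Lemma expectation_like_mean (T : finType) (p X : T -> R) : (forall t, 0 <= p t) ->
  expectation_like (fun f => mean p (fun t => f (X t))).
Proof.
move=> p0; rewrite /mean; split.
- by move=> f g _ _; rewrite -big_split; apply: eq_bigr => t _; rewrite mulrDr.
- by move=> c f _; rewrite mulr_sumr; apply: eq_bigr => t _; rewrite mulrCA.
- by move=> f g _ _ fg; apply: ler_sum => t _; rewrite ler_wpM2l.
Qed.

Lemma finite_cdfE (T : finType) (p X : T -> R) x :
  finite_cdf p X x = mean p (fun t => ind_le x (X t)).
Proof.
rewrite /finite_cdf /mean /ind_le big_mkcond; apply: eq_bigr => t _.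
by case: (X t <= x)%R; rewrite ?mulr1 ?mulr0.
Qed.

Lemma meanD (T : finType) (p f g : T -> R) :
  mean p (fun t => f t + g t) = mean p f + mean p g.
Proof. by rewrite /mean -big_split; apply: eq_bigr => t _; rewrite mulrDr. Qed.

Lemma meanZ (T : finType) (p f : T -> R) c : mean p (fun t => c * f t) = c * mean p f.
Proof. by rewrite /mean mulr_sumr; apply: eq_bigr => t _; rewrite mulrCA. Qed.

Lemma mean_cst (T : finType) (p : T -> R) c : \sum_t p t = 1 -> mean p (fun=> c) = c.
Proof. by move=> p1; rewrite /mean -mulr_suml p1 mul1r. Qed.

Lemma varianceE (T : finType) (p f : T -> R) : \sum_t p t = 1 ->
  variance p f = mean p (fun t => f t ^+ 2) - mean p f ^+ 2.
Proof.
move=> p1; rewrite /variance.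
have -> : (fun t => (f t - mean p f) ^+ 2) =
   (fun t => f t ^+ 2 + (- mean p f *+ 2 * f t + mean p f ^+ 2)).
  by apply/funext => t; ring.
by rewrite !meanD meanZ mean_cst//; ring.
Qed.

Lemma variance_shift (T : finType) (p f : T -> R) c : \sum_t p t = 1 ->
  variance p (fun t => f t - c) = variance p f.
Proof.
move=> p1; rewrite /variance; congr mean; apply/funext => t; congr (_ ^+ 2).
by rewrite meanD mean_cst//; ring.
Qed.

(** The Laplace transform of the variables gives their moments in the limit;
    the limit mean is 0, so centering changes neither the limit variance nor
    the limit law. *)
Theorem clt_of_laplace (T : nat -> finType) (p X : forall n, T n -> R) (v : R) :
  0 < v -> (forall n t, 0 <= p n t) -> (forall n, \sum_t p n t = 1) ->
  (forall t, mean (p n) (fun w => expR (t * X n w)) @[n --> \oo] --> expR (v * t ^+ 2 / 2)) ->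
  variance (p n) (X n) @[n --> \oo] --> v /\
  cvg_in_distribution p (fun n w => X n w - mean (p n) (X n)) (centered_gaussian v).
Proof.
move=> v0 p0 p1 cX; pose s := Num.sqrt v.
have s0 : s != 0 by rewrite gt_eqF// sqrtr_gt0.
have s2 : s ^+ 2 = v by rewrite sqr_sqrtr// ltW.
have eG := expectation_like_gaussian s0.
have [G1 G2] := gaussian_mean_moments s0.
pose Ln n f := mean (p n) (fun w => f (X n w)).
have eLn n : expectation_like (Ln n) by exact: expectation_like_mean.
have cLn t : Ln n (fun x => expR (t * x)) @[n --> \oo] --> gaussian_mean s (fun x => expR (t * x)).
  by rewrite gaussian_mean_exp// s2; exact: cX.
have m1 : mean (p n) (X n) @[n --> \oo] --> (0 : R).
  by have [_] := mean_cvg_pow eLn eG cLn 1; rewrite G1.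
have m2 : mean (p n) (fun w => X n w ^+ 2) @[n --> \oo] --> v.
  by have [_] := mean_cvg_pow eLn eG cLn 2; rewrite G2 s2.
split.
  under eq_fun do rewrite varianceE//.
  have -> : v = v - 0 * 0 by rewrite mul0r subr0.
  apply: cvgB => //; under eq_fun do rewrite expr2.
  exact: cvgM.
pose Mn n f := mean (p n) (fun w => f (X n w - mean (p n) (X n))).
have eMn n : expectation_like (Mn n) by exact: expectation_like_mean.
have cMn t : Mn n (fun x => expR (t * x)) @[n --> \oo] --> gaussian_mean s (fun x => expR (t * x)).
  have E n : Mn n (fun x => expR (t * x)) =
      expR (- t * mean (p n) (X n)) * Ln n (fun x => expR (t * x)).
    rewrite /Mn /Ln -meanZ; congr mean; apply/funext => w.
    by rewrite -expRD; congr expR; ring.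
  rewrite (_ : (fun n => _) = (fun n => expR (- t * mean (p n) (X n)) *
     Ln n (fun x => expR (t * x)))); last exact/funext/E.
  rewrite -[gaussian_mean s _]mul1r; apply: cvgM; last exact: cLn.
  rewrite -[1]expR0; apply: continuous_cvg; first exact: continuous_expR.
  by rewrite -(mulr0 (- t)); apply: cvgMr.
move=> x; rewrite /centered_gaussian.
have -> : (fun y : R => fine (normal_prob 0 (Num.sqrt v) `]-oo, y]%classic)) =
    (fun y => gaussian_mean s (ind_le y)).
  by apply/funext => y; rewrite gaussian_mean_ind_le.
move=> cF; have := laplace_cvg_cdf eMn eG cMn cF.
have -> : (fun n => Mn n (ind_le x)) =
    (fun n => finite_cdf (p n) (fun w => X n w - mean (p n) (X n)) x).
  by apply/funext => n; rewrite finite_cdfE.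
by rewrite gaussian_mean_ind_le.
Qed.

End CentralLimit.

(** * Auxiliary asymptotics *)

Section Asymptotics.
Variable R : realType.

Lemma cvg_ln_sqrt : ln (2 * n + 1)%:R / Num.sqrt n%:R @[n --> \oo] --> (0 : R).
Proof.
apply/cvgrPdist_le => e e0; near=> n.
have n0 : (0 < n)%N by near: n; exact: nbhs_infty_gt.
have nR : 0 < n%:R :> R by rewrite ltr0n.
have sn0 : 0 < Num.sqrt n%:R :> R by rewrite sqrtr_gt0.
have x1 : 1 <= (2 * n + 1)%:R :> R by rewrite ler1n addn1.
have l0 := ln_ge0 x1.
rewrite sub0r normrN ger0_norm; last by rewrite divr_ge0// ltW.
rewrite ler_pdivrMr// -(@ler_pXn2r _ 4)// ?nnegrE; last by rewrite mulr_ge0// ltW.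
(* One term of the exponential series: y^4 / 4! <= exp y at y = ln (2 n + 1). *)
have : ln (2 * n + 1)%:R ^+ 4 / 24 <= (2 * n + 1)%:R :> R.
  have := expR_ge1Dxn 3 l0; rewrite lnK ?posrE; last exact: lt_le_trans x1.
  by rewrite (_ : 4`! = 24)%N//; lra.
have -> : (e * Num.sqrt n%:R) ^+ 4 = e ^+ 4 * n%:R ^+ 2.
  by rewrite exprMn (exprM (Num.sqrt _) 2 2) sqr_sqrtr// ltW.
have : 72 / e ^+ 4 <= n%:R by near: n; exact: nbhs_infty_ger.
rewrite ler_pdivrMr ?exprn_gt0// => H1 H2.
have n1 : 1 <= n%:R :> R by rewrite ler1n.
have H3 : 72 * n%:R <= n%:R * e ^+ 4 * n%:R by rewrite ler_wpM2r// ltW.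
move: H2; rewrite ler_pdivrMr// natrD natrM => H2.
apply: le_trans H2 _; rewrite expr2; lra.
Unshelve. all: by end_near. Qed.

Lemma expRN_ge (x : R) : 2 - expR x <= expR (- x).
Proof.
have := expR_ge1Dx x; have e0 := expR_gt0 x.
have : expR x * expR (- x) = 1 by rewrite expRxMexpNx_1.
have := sqr_ge0 (expR x - 1); rewrite expr2 => H1 H2 _.
rewrite -(ler_pM2l e0) H2; lra.
Qed.

Lemma cvg_dist_expR (x y : nat -> R) : x n @[n --> \oo] --> 0 ->
  (\forall n \near \oo, `|y n - 1| <= expR (x n) - 1) -> y n @[n --> \oo] --> (1 : R).
Proof.
move=> cx H; apply/cvgrPdist_le => e e0.
have cE : expR (x n) @[n --> \oo] --> (1 : R).
  by rewrite -[1]expR0; apply: continuous_cvg => //; exact: continuous_expR.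
near=> n; rewrite distrC; have : `|y n - 1| <= expR (x n) - 1 by near: n.
move/le_trans; apply; rewrite (le_trans (ler_norm _))// distrC.
by near: n; move/cvgrPdist_le : cE; apply.
Unshelve. all: by end_near. Qed.

(** Convexity of the exponential on the segment from 0 to y, from the tangent
    at a y. *)
Lemma expR_interpolation (a y : R) : 0 <= a <= 1 -> expR (a * y) <= 1 - a + a * expR y.
Proof.
move=> /andP[a0 a1]; have z0 := expR_gt0 (a * y).
have H1 : expR (a * y) * (1 + (y - a * y)) <= expR y.
  have := expR_ge1Dx (y - a * y); rewrite -(ler_pM2l z0) => /le_trans; apply.
  by rewrite -expRD addrC subrK.
have H2 : expR (a * y) * (1 - a * y) <= 1.
  have := expR_ge1Dx (- (a * y)); rewrite -(ler_pM2l z0) => /le_trans; apply.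
  by rewrite -expRD subrr expR0.
have : a * (expR (a * y) * (1 + (y - a * y))) <= a * expR y by rewrite ler_wpM2l.
have : (1 - a) * (expR (a * y) * (1 - a * y)) <= (1 - a) * 1 by rewrite ler_wpM2l// subr_ge0.
lra.
Qed.

End Asymptotics.

(** * Laplace transforms under the quenched and averaged measures *)

Section Model.
Variables (R : realType) (beta B : R).
Hypothesis beta0 : 0 <= beta.

Lemma partition_function_gt0 N (d : 'I_N -> nat) (b : R) (G : pairing d) :
  0 < partition_function beta b G.
Proof.
rewrite /partition_function (bigD1 [ffun=> true])//= ltr_pwDl ?expR_gt0//.
by rewrite sumr_ge0// => s _; exact: expR_ge0.
Qed.

Lemma quenched_ge0 N (d : 'I_N -> nat) (G : pairing d) s : 0 <= quenched beta B G s.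
Proof. by rewrite divr_ge0 ?expR_ge0// ltW// partition_function_gt0. Qed.

Lemma sum_quenched N (d : 'I_N -> nat) (G : pairing d) : \sum_s quenched beta B G s = 1.
Proof. by rewrite -mulr_suml divff// gt_eqF// partition_function_gt0. Qed.

Lemma CM_law_ge0 N (d : 'I_N -> nat) (G : pairing d) : 0 <= CM_law R G.
Proof. by rewrite invr_ge0. Qed.

Lemma sum_CM_law N : \sum_(G : pairing (@degree2 N)) CM_law R G = 1.
Proof.
rewrite /CM_law sumr_const -[_^-1 *+ _]mulr_natr mulVf// pnatr_eq0 -lt0n.
exact: card_pairing_gt0.
Qed.

Lemma mean_averaged N (d : 'I_N -> nat) (f : {ffun 'I_N -> bool} -> R) :
  mean (averaged_quenched d beta B) f =
  mean (@CM_law R N d) (fun G => mean (quenched beta B G) f).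
Proof.
rewrite /mean /averaged_quenched /mean.
under eq_bigr do rewrite mulr_suml; rewrite exchange_big/=.
by apply: eq_bigr => G _; rewrite mulr_sumr; apply: eq_bigr => s _; rewrite mulrA.
Qed.

Variable C : forall N, pairing (@degree2 N) -> seq nat.
Hypothesis sumC : forall N (G : pairing (@degree2 N)), sumn (C G) = N.
Hypothesis ZC : forall N b (G : pairing (@degree2 N)),
  partition_function beta b G = \prod_(L <- C G) \tr (transfer_mx beta b ^+ L).
Hypothesis countC : forall N,
  (\sum_(G : pairing (@degree2 N)) 3 ^ size (C G) = (2 * N + 1) * #|{: pairing (@degree2 N)}|)%N.

Definition scaled_spin N (s : {ffun 'I_N -> bool}) : R :=
  total_spin R s / Num.sqrt N%:R - magnetization beta B * N%:R / Num.sqrt N%:R.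

(** The part of Z_G(B + u) / Z_G(B) that depends on the graph. *)
Definition cycle_ratio N (G : pairing (@degree2 N)) (u : R) : R :=
  \prod_(L <- C G) (1 + eigen_ratio beta (B + u) ^+ L) /
  \prod_(L <- C G) (1 + eigen_ratio beta B ^+ L).

(** The part of the Laplace transform at t that does not depend on the graph;
    the linear term comes from the centering of the spin. *)
Definition bulk_factor N (t : R) : R :=
  expR (N%:R * (pressure beta (B + t / Num.sqrt N%:R) - pressure beta B
                - magnetization beta B * (t / Num.sqrt N%:R))).

Lemma prod_eigen_gt0 N (G : pairing (@degree2 N)) b :
  0 < \prod_(L <- C G) (1 + eigen_ratio beta b ^+ L).
Proof.
rewrite prodr_gt0// => L _; have /andP[r0 _] := eigen_ratio_itv beta0 b.
by rewrite ltr_pwDl// exprn_ge0.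
Qed.

(** A linear term in the total spin is a shift of the field, so the Laplace
    transform is a ratio of partition functions. *)
Lemma quenched_laplace N (G : pairing (@degree2 N)) t :
  mean (quenched beta B G) (fun s => expR (t * scaled_spin s)) =
  bulk_factor N t * cycle_ratio G (t / Num.sqrt N%:R).
Proof.
set u := t / _.
transitivity (partition_function beta (B + u) G / partition_function beta B G *
   expR (- (N%:R * (magnetization beta B * u)))).
  rewrite /mean [in RHS]/partition_function !mulr_suml; apply: eq_bigr => s _.
  rewrite /quenched mulrAC [RHS]mulrAC; congr (_ / _).
  rewrite /boltzmann_weight -!expRD; congr expR; rewrite /scaled_spin /u; ring.
rewrite !(partition_function_cycles (sumC G) (ZC _ G)) /bulk_factor -/u /cycle_ratio.
have lE b : lambda_plus beta b ^+ N = expR (N%:R * pressure beta b).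
  by rewrite expRM_natl /pressure lnK// posrE lambda_plus_gt0.
rewrite !lE !mulrBr !expRD !expRN; field.
by rewrite !gt_eqF ?expR_gt0 ?prod_eigen_gt0.
Qed.

Lemma cycle_ratio_near : exists2 c, 0 <= c & exists2 delta, 0 < delta &
  forall u, `|u| <= delta -> forall N (G : pairing (@degree2 N)),
    expR (- (c * `|u| * (size (C G))%:R)) <= cycle_ratio G u
      <= expR (c * `|u| * (size (C G))%:R).
Proof.
have [c c0 [delta d0 H]] := prod_eigen_ratio_near beta0 B.
exists c => //; exists delta => // u /H Hu N G; have [H1 H2] := Hu (C G).
rewrite /cycle_ratio ler_pdivrMr ?prod_eigen_gt0// ler_pdivlMr ?prod_eigen_gt0// H1 andbT.
by rewrite expRN mulrC ler_pdivrMr ?expR_gt0// mulrC.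
Qed.

Lemma cvg_bulk_factor t : bulk_factor n t @[n --> \oo] --> expR (chi1d beta B * t ^+ 2 / 2).
Proof.
apply: continuous_cvg; first exact: continuous_expR.
exact: cvg_taylor2 (is_derive_pressure beta) (is_derive_magnetization beta B).
Qed.

Lemma cvg_small_field t : t / Num.sqrt n%:R @[n --> \oo] --> (0 : R).
Proof. by rewrite -(mulr0 t); apply: cvgMr; exact: cvg_sqrt_natV. Qed.

Lemma quenched_laplace_cvg (G : forall N, pairing (@degree2 N)) t :
  (size (C (G n)))%:R / Num.sqrt n%:R @[n --> \oo] --> (0 : R) ->
  mean (quenched beta B (G n)) (fun s => expR (t * scaled_spin s)) @[n --> \oo]
    --> expR (chi1d beta B * t ^+ 2 / 2).
Proof.
move=> cK; under eq_fun do rewrite quenched_laplace.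
rewrite -[expR (chi1d _ _ * _ / _)]mulr1; apply: cvgM; first exact: cvg_bulk_factor.
have [c c0 [delta d0 H]] := cycle_ratio_near.
apply: (@cvg_dist_expR _ (fun n => c * `|t| * ((size (C (G n)))%:R / Num.sqrt n%:R))).
  by rewrite -(mulr0 (c * `|t|)); apply: cvgMr.
near=> n.
have un : `|t / Num.sqrt n%:R| <= delta.
  rewrite -[X in X <= _]normrN -[X in `|X|]sub0r.
  by near: n; move/cvgrPdist_le : (cvg_small_field t); apply.
have /andP[H1 H2] := H _ un n (G n).
have E : c * `|t / Num.sqrt n%:R| * (size (C (G n)))%:R =
    c * `|t| * ((size (C (G n)))%:R / Num.sqrt n%:R).
  by rewrite normrM normfV (ger0_norm (sqrtr_ge0 _)); ring.
rewrite -E; have := expRN_ge (c * `|t / Num.sqrt n%:R| * (size (C (G n)))%:R).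
rewrite ler_norml; lra.
Unshelve. all: by end_near. Qed.

(** Interpolation between E[1] = 1 and E[3^K] / (2 N + 1) = 1. *)
Lemma mean_cycle_count N (theta : R) : 0 <= theta <= ln 3 ->
  mean (@CM_law R N (@degree2 N)) (fun G => expR (theta * (size (C G))%:R)) <=
  expR (theta / ln 3 * ln (2 * N + 1)%:R).
Proof.
have l3 : 0 < ln 3 :> R by rewrite ln_gt0// ltr1n.
move=> /andP[t0 t1]; set a := theta / ln 3; set l := ln _.
have x0 : 0 < (2 * N + 1)%:R :> R by rewrite ltr0n addn1.
have a01 : 0 <= a <= 1 by rewrite divr_ge0 ?(ltW l3)//= ler_pdivrMr// mul1r.
(* Chosen such that exp(y G) = 3^K / (2 N + 1) has mean 1. *)
pose y (G : pairing (@degree2 N)) : R := (size (C G))%:R * ln 3 - l.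
have E3 G : expR (y G) = 3 ^+ size (C G) / (2 * N + 1)%:R.
  by rewrite expRD expRN expRM_natl !lnK// posrE.
have my : mean (@CM_law R N (@degree2 N)) (fun G => expR (y G)) = 1.
  rewrite /mean /CM_law -mulr_sumr; under eq_bigr do rewrite E3.
  rewrite -mulr_suml.
  under eq_bigr do rewrite -natrX.
  rewrite -natr_sum countC natrM [_ * _ / _]mulrAC divff ?(gt_eqF x0)// mul1r mulVf//.
  by rewrite pnatr_eq0 -lt0n card_pairing_gt0.
apply: (@le_trans _ _ (mean (@CM_law R N (@degree2 N))
   (fun G => expR (a * l) * ((1 - a) + a * expR (y G))))).
  rewrite /mean; apply: ler_sum => G _; rewrite ler_wpM2l ?CM_law_ge0//.
  have -> : theta * (size (C G))%:R = a * l + a * y G.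
    by rewrite /a /y; field; rewrite gt_eqF.
  by rewrite expRD ler_wpM2l ?expR_ge0// expR_interpolation.
by rewrite meanZ meanD meanZ my mean_cst ?sum_CM_law// mulr1 subrK mulr1.
Qed.

(** The bounds exp(- x) >= 2 - exp(x) and [mean_cycle_count] show that the
    graph-dependent factor has mean within exp(o(1)) - 1 of 1: the exponent
    is a multiple of ln(2 N + 1) / sqrt N. *)
Lemma averaged_laplace_cvg t :
  mean (averaged_quenched (@degree2 n) beta B) (fun s => expR (t * scaled_spin s)) @[n --> \oo]
    --> expR (chi1d beta B * t ^+ 2 / 2).
Proof.
pose rho n := mean (@CM_law R n (@degree2 n)) (fun G => cycle_ratio G (t / Num.sqrt n%:R)).
have E n : mean (averaged_quenched (@degree2 n) beta B) (fun s => expR (t * scaled_spin s)) =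
    bulk_factor n t * rho n.
  rewrite mean_averaged /rho -meanZ; congr mean; apply/funext => G.
  exact: quenched_laplace.
under eq_fun do rewrite E.
rewrite -[expR (chi1d _ _ * _ / _)]mulr1; apply: cvgM; first exact: cvg_bulk_factor.
have [c c0 [delta d0 H]] := cycle_ratio_near.
have l3 : 0 < ln 3 :> R by rewrite ln_gt0// ltr1n.
apply: (@cvg_dist_expR _ (fun n => c * `|t| / ln 3 * (ln (2 * n + 1)%:R / Num.sqrt n%:R))).
  by rewrite -(mulr0 (c * `|t| / ln 3)); apply: cvgMr; exact: cvg_ln_sqrt.
near=> n.
have un : `|t / Num.sqrt n%:R| <= Num.min delta (ln 3 / (c + 1)).
  rewrite -[X in X <= _]normrN -[X in `|X|]sub0r.
  near: n; move/cvgrPdist_le : (cvg_small_field t); apply.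
  by rewrite lt_min d0 divr_gt0// ltr_wpDl.
move: un; rewrite le_min => /andP[un u3]; set u := t / Num.sqrt n%:R in un u3 *.
pose theta := c * `|u|.
have theta_itv : 0 <= theta <= ln 3.
  rewrite mulr_ge0//=; move: u3; rewrite ler_pdivlMr; last by rewrite ltr_wpDl.
  by apply: le_trans; rewrite /theta mulrC ler_wpM2l// lerDl.
have mE := mean_cycle_count n theta_itv.
have eE : theta / ln 3 * ln (2 * n + 1)%:R = c * `|t| / ln 3 * (ln (2 * n + 1)%:R / Num.sqrt n%:R).
  by rewrite /theta /u normrM normfV (ger0_norm (sqrtr_ge0 _)); ring.
rewrite eE in mE.
have up : rho n <= mean (@CM_law R n (@degree2 n)) (fun G => expR (theta * (size (C G))%:R)).
  rewrite /rho /mean; apply: ler_sum => G _; rewrite ler_wpM2l ?CM_law_ge0//.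
  by have /andP[] := H u un n G.
have lo : 2 - mean (@CM_law R n (@degree2 n)) (fun G => expR (theta * (size (C G))%:R)) <= rho n.
  have -> : 2 - mean (@CM_law R n (@degree2 n)) (fun G => expR (theta * (size (C G))%:R)) =
     mean (@CM_law R n (@degree2 n)) (fun G => 2 + -1 * expR (theta * (size (C G))%:R)).
    by rewrite meanD meanZ mean_cst ?sum_CM_law// mulN1r.
  rewrite /rho /mean; apply: ler_sum => G _; rewrite ler_wpM2l ?CM_law_ge0// mulN1r.
  by have /andP[+ _] := H u un n G; apply: le_trans; exact: expRN_ge.
have up' := le_trans up mE.
have lo' : 2 - expR (c * `|t| / ln 3 * (ln (2 * n + 1)%:R / Num.sqrt n%:R)) <= rho n.
  by apply: le_trans lo; rewrite lerB.
rewrite -[X in X - 1]/(rho n) ler_norml; apply/andP; split; lra.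
Unshelve. all: by end_near. Qed.

End Model.

(** * Almost sure bound on the number of cycles *)

Section AlmostSurely.
Variable R : realType.
Variable C : forall N, pairing (@degree2 N) -> seq nat.
Hypothesis countC : forall N,
  (\sum_(G : pairing (@degree2 N)) 3 ^ size (C G) = (2 * N + 1) * #|{: pairing (@degree2 N)}|)%N.

(** Markov's inequality for 3^K gives the bound (2 N + 1)^(-2), which is
    weakened to a telescoping one. *)
Lemma many_cycles_prob N :
  \sum_(G : pairing (@degree2 N) | ((2 * N + 1) ^ 3 < 3 ^ size (C G))%N) CM_law R G
    <= 2 / N.+1%:R - 2 / N.+2%:R.
Proof.
have x0 : 0 < (2 * N + 1)%:R :> R by rewrite ltr0n addn1.
have p0 : 0 < #|{: pairing (@degree2 N)}|%:R :> R by rewrite ltr0n card_pairing_gt0.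
apply: (@le_trans _ _ (\sum_(G : pairing (@degree2 N)) CM_law R G * (3 ^ size (C G))%:R / (2 * N + 1)%:R ^+ 3)).
  rewrite big_mkcond; apply: ler_sum => G _; case: ifPn => [many|_]; last first.
    by rewrite divr_ge0 ?exprn_ge0// ?(ltW x0)// mulr_ge0// CM_law_ge0.
  rewrite -mulrA ler_peMr ?CM_law_ge0// ler_pdivlMr ?exprn_gt0// mul1r -natrX ler_nat.
  exact: ltnW.
rewrite -mulr_suml -mulr_sumr -natr_sum countC natrM.
have -> : #|{: pairing (@degree2 N)}|%:R^-1 * ((2 * N + 1)%:R * #|{: pairing (@degree2 N)}|%:R)
    / (2 * N + 1)%:R ^+ 3 = (2 * N + 1)%:R ^- 2 :> R.
  by move: x0 p0; move: (_%:R) (#|_|%:R) => x p x0 p0; field; rewrite !gt_eqF.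
have -> : 2 / N.+1%:R - 2 / N.+2%:R = 2 / (N.+1%:R * N.+2%:R) :> R.
  have a0 : N.+1%:R != 0 :> R by rewrite pnatr_eq0.
  have b0 : N.+2%:R != 0 :> R by rewrite pnatr_eq0.
  have E : N.+2%:R = N.+1%:R + 1 :> R by rewrite natr1.
  by rewrite E in b0 *; move: a0 b0; move: (N.+1%:R : R) => x a0 b0; field; rewrite a0 b0.
have y0 : 0 < N.+1%:R * N.+2%:R :> R by rewrite mulr_gt0.
rewrite ler_pdivlMr// mulrC ler_pdivrMr ?exprn_gt0// -natrX -!natrM ler_nat.
nia.
Qed.

(** By Borel-Cantelli, eventually 3^K <= (2 N + 1)^3, that is
    K = O(ln N). *)
Lemma cycle_count_ae (disp : measure_display) (Omega : measurableType disp)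
    (P : probability Omega R) (G : forall N, Omega -> pairing (@degree2 N)) :
  (forall N g, measurable (G N @^-1` [set g]) /\
               P (G N @^-1` [set g]) = (CM_law R g)%:E) ->
  {ae P, forall w, (size (C (G n w)))%:R / Num.sqrt n%:R @[n --> \oo] --> (0 : R)}.
Proof.
move=> GP.
(* The exponent 3 leaves a summable probability after Markov's inequality. *)
pose bad N (g : pairing (@degree2 N)) := ((2 * N + 1) ^ 3 < 3 ^ size (C g))%N.
pose F N := [set w | bad N (G N w)].
have FP N : measurable (F N) /\ (P (F N) <= (2 / N.+1%:R - 2 / N.+2%:R)%:E)%E.
  have -> : F N = \big[setU/set0]_(g | bad N g) (G N @^-1` [set g]).
    apply/seteqP; split=> w; first by rewrite /F/= => b; rewrite (bigD1 (G N w))//=; left.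
    apply: (big_ind (fun A : set Omega => A w -> F N w)) => // [A A' HA HA' []//|g bg gw].
    by rewrite /F/= (gw : G N w = g).
  suff [mA PA] : measurable (\big[setU/set0]_(g | bad N g) (G N @^-1` [set g])) /\
     (P (\big[setU/set0]_(g | bad N g) (G N @^-1` [set g])) <= (\sum_(g | bad N g) CM_law R g)%:E)%E.
    by split=> //; apply: (le_trans PA); rewrite lee_fin many_cycles_prob.
  apply: (big_ind2 (fun A (s : R) => measurable A /\ (P A <= s%:E)%E)).
  - by split => //; rewrite measure0.
  - move=> A s A' s' [mA PA] [mA' PA']; split; first exact: measurableU.
    by apply: (le_trans (measureU2 _ mA mA')); rewrite EFinD leeD.
  - by move=> g _; have [mg ->] := GP N g.
have F0 : P (lim_sup_set F) = 0.
  apply: lim_sup_set_cvg0; first by move=> N; have [] := FP N.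
  apply: (@le_lt_trans _ _ 2%:E); last exact: ltry.
  apply: lime_le; first by apply: is_cvg_nneseries.
  apply: nearW => k.
  suff : (\sum_(0 <= n < k) P (F n) <= (2 - 2 / k.+1%:R)%:E)%E.
    by move/le_trans; apply; rewrite lee_fin gerBl divr_ge0.
  elim: k => [|k IH]; first by rewrite big_nil divr1 subrr.
  rewrite big_nat_recr//=; apply: (le_trans (leeD IH (FP k).2)).
  by rewrite -EFinD lee_fin addrA subrK.
exists (lim_sup_set F); split => //.
  apply: bigcap_measurable => // n _; apply: bigcup_measurable => k _.
  by have [] := FP k.
move=> w /= Hw; apply: contrapT => Hlim; apply: Hw.
have [n Hn] : exists n, forall j, (n <= j)%N -> ~~ bad j (G j w).
  apply: contrapT => Hno; apply: Hlim => n _.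
  apply: contrapT => Hj; apply: Hno; exists n => j nj.
  by apply/negP => bj; apply: Hj; exists j.
have l3 : 0 < ln 3 :> R by rewrite ln_gt0// ltr1n.
have cv : 3 / ln 3 * (ln (2 * n + 1)%:R / Num.sqrt n%:R) @[n --> \oo] --> (0 : R).
  by rewrite -(mulr0 (3 / ln 3)); apply: cvgMr; exact: cvg_ln_sqrt.
apply: (squeeze_cvgr _ (cvg_cst 0) cv); near=> k.
rewrite divr_ge0 ?sqrtr_ge0//= mulrA ler_wpM2r ?invr_ge0 ?sqrtr_ge0//.
have : ~~ bad k (G k w) by apply: Hn; near: k; exact: nbhs_infty_ge.
rewrite /bad -leqNgt -(ler_nat R) !natrX => H.
have x0 : 0 < (2 * k + 1)%:R :> R by rewrite ltr0n addn1.
have : ln (3 ^+ size (C (G k w))) <= ln ((2 * k + 1)%:R ^+ 3) :> R.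
  by rewrite ler_ln ?posrE ?exprn_gt0.
rewrite !lnXn// => lH.
by rewrite mulrAC ler_pdivlMr// mulrC mulr_natr mulr_natl.
Unshelve. all: by end_near. Qed.

End AlmostSurely.

Theorem theorem1p5 (R : realType) (beta B : R) (hbeta : 0 <= beta) :
  let P N := averaged_quenched (@degree2 N) beta B in
  exists chi : R,
  [/\ thermodynamic_limit
        (fun N (G : pairing (@degree2 N)) => susceptibility beta B G) chi,
      cvg_in_distribution P
        (fun N s => (total_spin R s - mean (P N) (@total_spin R N))
                    / Num.sqrt N%:R)
        (centered_gaussian chi),
      chi = susceptibility_1d beta B
    & susceptibility_1d beta B =
        cosh B * expR (- (4 * beta))
        / (sinh B ^+ 2 + expR (- (4 * beta))) `^ (3 / 2)].
Proof.
move=> P.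
pose C N := sval (cid (cycle_structure N)).
have CP N := svalP (cid (cycle_structure N)).
have sumC N (G : pairing (@degree2 N)) : sumn (C N G) = N by have [H _ _] := CP N; exact: H.
have ZC N b (G : pairing (@degree2 N)) :
    partition_function beta b G = \prod_(L <- C N G) \tr (transfer_mx beta b ^+ L).
  by have [_ H _] := CP N; exact: H.
have countC N : (\sum_(G : pairing (@degree2 N)) 3 ^ size (C N G) =
    (2 * N + 1) * #|{: pairing (@degree2 N)}|)%N by have [_ _ H] := CP N.
exists (chi1d beta B); rewrite susceptibility_1dE; split=> //; last exact: chi1dE.
- move=> disp Omega Pr G GP.
  apply: filterS (cycle_count_ae countC GP) => w cK.
  have [cV _] := clt_of_laplace (chi1d_gt0 beta B)
    (fun N s => quenched_ge0 beta B (G N w) s) (fun N => sum_quenched beta B (G N w))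
    (fun t => @quenched_laplace_cvg R beta B hbeta C sumC ZC (fun N => G N w) t cK).
  rewrite (_ : (fun N => _) = (fun N => variance (quenched beta B (G N w)) (scaled_spin beta B (N:=N))))//.
  by apply/funext => N; rewrite /susceptibility /scaled_spin variance_shift// sum_quenched.
have P0 N s : 0 <= P N s.
  by rewrite /P /averaged_quenched /mean sumr_ge0// => G _; rewrite mulr_ge0 ?CM_law_ge0 ?quenched_ge0.
have P1 N : \sum_s P N s = 1.
  rewrite /P /averaged_quenched /mean exchange_big/=.
  by under eq_bigr do rewrite -mulr_sumr sum_quenched mulr1; rewrite sum_CM_law.
have [_ cD] := clt_of_laplace (chi1d_gt0 beta B) P0 P1
   (fun t => @averaged_laplace_cvg R beta B hbeta C sumC ZC countC t).
have mX N : mean (P N) (@scaled_spin R beta B N) = mean (P N) (@total_spin R N) / Num.sqrt N%:R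
    - magnetization beta B * N%:R / Num.sqrt N%:R.
  rewrite /scaled_spin meanD mean_cst//; congr (_ - _).
  by rewrite mulrC -meanZ; congr mean; apply/funext => s; rewrite mulrC.
move=> x cx; have := cD x cx.
rewrite (_ : (fun N => finite_cdf (P N) _ x) = (fun N => finite_cdf (P N)
   (fun s => (total_spin R s - mean (P N) (@total_spin R N)) / Num.sqrt N%:R) x))//.
apply/funext => N; congr (finite_cdf _ _ x); apply/funext => s.
by rewrite mX /scaled_spin; ring.
Qed.
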